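(* There exists an absolute constant $C>0$ such that the following holds. Let $X=(X_1,\ldots,X_n)$ be a random vector whose coordinates $X_i$ are real-valued independent random variables. Let $t,p\ge 0$ be such that $$\mathcal{L}(X_i,t)\le p\quad\text{for all } i=1,\ldots,n.$$ Then for every non-zero $m\times n$ real matrix $A$, every $M\ge 1$ and every $\varepsilon\in(0,1)$ we have $$\mathcal{L}(AX,\,Mt\|A\|_{\mathrm{HS}})\le (C_\varepsilon Mp)^{\lceil(1-\varepsilon)r(A)\rceil},$$ where $C_\varepsilon=C/\sqrt{\varepsilon}$.
   Context: For a random vector $Z$ taking values in $\mathbb{R}^k$, the concentration function is $\mathcal{L}(Z,t)=\max_{u\in\mathbb{R}^k}\mathbb{P}\{\|Z-u\|_2\le t\}$ for $t\ge 0$, where $\|\cdot\|_2$ is the Euclidean norm (for real-valued $X_i$, $k=1$). $\|A\|_{\mathrm{HS}}$ denotes the Hilbert-Schmidt (Frobenius) norm and $\|A\|$ the operator (spectral) norm of $A$. The stable rank of $A$ is defined as $r(A)=\left\lfloor \|A\|_{\mathrm{HS}}^2/\|A\|^2\right\rfloor$. *)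

(* Defs.v *)
From mathcomp Require Import all_boot all_order all_algebra.
From mathcomp Require Import all_classical all_reals all_analysis.
Set Implicit Arguments.
Unset Strict Implicit.
Unset Printing Implicit Defensive.
Import Order.TTheory GRing.Theory Num.Theory.
Local Open Scope classical_set_scope.
Local Open Scope ring_scope.

(* The library norm `|_| on matrices is the sup norm, hence the norms below. *)
Definition l2norm (R : realType) (k : nat) (v : 'cV[R]_k) : R :=
  Num.sqrt (\sum_(i < k) v i 0 ^+ 2).

Definition hs_norm (R : realType) (m n : nat) (A : 'M[R]_(m, n)) : R :=
  Num.sqrt (\sum_(i < m) \sum_(j < n) A i j ^+ 2).

(* The set is nonempty and bounded, so its real-valued sup is the actual one. *)
Definition op_norm (R : realType) (m n : nat) (A : 'M[R]_(m, n)) : R :=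
  sup [set l2norm (A *m x) | x in [set x : 'cV[R]_n | l2norm x <= 1]].

Definition stable_rank (R : realType) (m n : nat) (A : 'M[R]_(m, n)) : int :=
  Num.floor (hs_norm A ^+ 2 / op_norm A ^+ 2).

(* Written as a supremum, which makes sense without knowing beforehand that
   the maximum is attained. *)
Definition concentration (d : measure_display) (T : measurableType d)
    (R : realType) (P : probability T R) (k : nat) (Z : T -> 'cV[R]_k)
    (t : R) : \bar R :=
  ereal_sup (range (fun u : 'cV[R]_k => P [set w | l2norm (Z w - u) <= t])).

Definition mutually_independent (d : measure_display) (T : measurableType d)
    (R : realType) (P : probability T R) (n : nat)
    (X : 'I_n -> {RV P >-> R}) : Prop :=
  forall (J : {set 'I_n}) (B : 'I_n -> set R),
    (forall i, measurable (B i)) ->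
    P (\bigcap_(i in [set` J]) (X i @^-1` B i)) =
    (\prod_(i in J) P (X i @^-1` B i))%E.

Definition random_vector (d : measure_display) (T : measurableType d)
    (R : realType) (P : probability T R) (n : nat)
    (X : 'I_n -> {RV P >-> R}) : T -> 'cV[R]_n :=
  fun w => \col_(i < n) X i w.

(* A real random variable, as a random vector in dimension k = 1. *)
Definition scalar_vector (d : measure_display) (T : measurableType d)
    (R : realType) (P : probability T R) (Y : {RV P >-> R}) : T -> 'cV[R]_1 :=
  fun w => \col_(i < 1) Y w.

(* Main.v *)
(* Let [B] be a suitable multiple of [A] and [E_d] the sum of the Gram determinants of
   all d-tuples of columns of [B].  It is enough to bound [E exp(- |B X - u|^2)] by
   [(C p)^d d^(d/2) exp(|B|_HS^2) / sqrt E_d], because choosing the columns one at a time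
   gives [E_d >= (eps |A|_HS^2)^d] for [A] and [d = ceil((1 - eps) r(A))].  The Gaussian
   is written as a mean of characters [cos <g, z>].  Drawing d-tuples of columns with
   probability proportional to their Gram determinant, with [c_i] the probability that
   column [i] is drawn, Hoelder's inequality bounds the mean of the product of the
   characteristic functions [phi_i] by a geometric mean of integrals over single tuples.
   Such an integral is small after [|phi_i|^(1/c_i)] has been dominated by a combination
   of dilates of [|phi_i|^2], by the doubling [1 - |phi(2y)|^2 <= 4 (1 - |phi(y)|^2)]:
   it is then a small ball probability for d symmetrised variables, estimated one
   coordinate at a time.  The domination needs [c_i <= 1/2]; a column with a larger [c_i]
   is removed by conditioning, which lowers [d] by one.  Everything is first done for
   finitely supported variables, so that all expectations are finite sums. *)

Require Import Defs.
From mathcomp Require Import all_boot all_order all_algebra all_fingroup.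
From mathcomp Require Import all_classical all_reals all_analysis.
From mathcomp Require Import measurable_realfun complex ring lra.
Set Implicit Arguments.
Unset Strict Implicit.
Unset Printing Implicit Defensive.
Import Order.TTheory GRing.Theory Num.Theory.
Import numFieldNormedType.Exports.
Local Open Scope classical_set_scope.
Local Open Scope ring_scope.

(** * Gram determinants *)

Section Gram.
Variable R : realFieldType.

Definition dot m (u v : 'cV[R]_m) : R := (u^T *m v) 0 0.

(** The squared volume of the parallelepiped spanned by the chosen columns. It vanishes when an
    index repeats, so sums may run over all maps [f]. *)
Definition gram_det m n (B : 'M[R]_(m, n)) d (f : 'I_d -> 'I_n) : R :=
  \det (\matrix_(k < d, l < d) dot (col (f k) B) (col (f l) B)).

(* For [b = 0] the junk value [0^-1 = 0] makes this the identity. *)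
Definition reject m (b : 'cV[R]_m) : 'M[R]_m :=
  1%:M - (dot b b)^-1 *: (b *m b^T).

Lemma dotE m (u v : 'cV[R]_m) : dot u v = \sum_k u k 0 * v k 0.
Proof. by rewrite /dot mxE; apply: eq_bigr => k _; rewrite mxE. Qed.

Lemma dotC m (u v : 'cV[R]_m) : dot u v = dot v u.
Proof. by rewrite !dotE; apply: eq_bigr => k _; rewrite mulrC. Qed.

Lemma dotDr m (u v w : 'cV[R]_m) : dot u (v + w) = dot u v + dot u w.
Proof. by rewrite /dot mulmxDr mxE. Qed.

Lemma dotZr m a (u v : 'cV[R]_m) : dot u (a *: v) = a * dot u v.
Proof. by rewrite /dot -scalemxAr mxE. Qed.

Lemma dotNr m (u v : 'cV[R]_m) : dot u (- v) = - dot u v.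
Proof. by rewrite -scaleN1r dotZr mulN1r. Qed.

Lemma dotBr m (u v w : 'cV[R]_m) : dot u (v - w) = dot u v - dot u w.
Proof. by rewrite dotDr dotNr. Qed.

Lemma dotDl m (u v w : 'cV[R]_m) : dot (u + v) w = dot u w + dot v w.
Proof. by rewrite dotC dotDr !(dotC w). Qed.

Lemma dotBl m (u v w : 'cV[R]_m) : dot (u - v) w = dot u w - dot v w.
Proof. by rewrite dotC dotBr !(dotC w). Qed.

Lemma dotZl m a (u v : 'cV[R]_m) : dot (a *: u) v = a * dot u v.
Proof. by rewrite dotC dotZr dotC. Qed.

Lemma dot_ge0 m (u : 'cV[R]_m) : 0 <= dot u u.
Proof. by rewrite dotE sumr_ge0 // => k _; rewrite -expr2 sqr_ge0. Qed.

Lemma dot_eq0 m (u : 'cV[R]_m) : (dot u u == 0) = (u == 0).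
Proof.
apply/eqP/eqP => [h|->]; last by rewrite dotE big1 // => k _; rewrite mxE mul0r.
apply/matrixP => k j; rewrite ord1 mxE; apply/eqP.
move/eqP: h; rewrite dotE psumr_eq0; last by move=> i _; rewrite -expr2 sqr_ge0.
by move=> /allP /(_ k (mem_index_enum _)); rewrite -expr2 sqrf_eq0.
Qed.

Lemma dot_mulmx m k (M : 'M[R]_(k, m)) (u : 'cV[R]_k) (v : 'cV[R]_m) :
  dot u (M *m v) = dot (M^T *m u) v.
Proof. by rewrite /dot trmx_mul trmxK mulmxA. Qed.

Lemma dot_sqr_le m (u v : 'cV[R]_m) : dot u v ^+ 2 <= dot u u * dot v v.
Proof.
have [/eqP|v0] := eqVneq (dot v v) 0.
  rewrite dot_eq0 => /eqP ->; have -> : (0 : 'cV[R]_m) = 0 *: 0 by rewrite scaler0.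
  by rewrite !dotZr !mul0r mulr0 expr2 mul0r.
have v1 : 0 < dot v v by rewrite lt_def v0 dot_ge0.
have := dot_ge0 (dot v v *: u - dot u v *: v).
rewrite !(dotBl, dotBr, dotZr, dotZl) (dotC v u) => h.
by rewrite -subr_ge0 -(pmulr_rge0 _ v1) (le_trans h) // le_eqVlt; apply/orP; left; apply/eqP; ring.
Qed.

Lemma col_mulmx k m n (j : 'I_n) (M : 'M[R]_(k, m)) (N : 'M[R]_(m, n)) :
  col j (M *m N) = M *m col j N.
Proof. by rewrite !colE mulmxA. Qed.

Lemma reject_mul m (b x : 'cV[R]_m) :
  reject b *m x = x - (dot b x / dot b b) *: b.
Proof.
rewrite /reject mulmxBl mul1mx -scalemxAl -mulmxA.
have -> : b *m (b^T *m x) = dot b x *: b.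
  by rewrite [b^T *m x]mx11_scalar mul_mx_scalar.
by rewrite scalerA mulrC.
Qed.

Lemma dot_reject m (b x y : 'cV[R]_m) :
  dot (reject b *m x) (reject b *m y) = dot x y - dot b x * dot b y / dot b b.
Proof.
rewrite !reject_mul.
have [->|b0] := eqVneq (dot b b) 0.
  by rewrite !(invr0, mulr0, scale0r, subr0).
rewrite !(dotBl, dotBr, dotZr, dotZl) (dotC x b).
by field.
Qed.

Lemma dot_reject_le m (b x : 'cV[R]_m) :
  dot (reject b *m x) (reject b *m x) <= dot x x.
Proof.
rewrite dot_reject lerBlDr lerDl -expr2 mulr_ge0 ?sqr_ge0 // invr_ge0.
exact: dot_ge0.
Qed.

Lemma reject_self m (b : 'cV[R]_m) : dot (reject b *m b) (reject b *m b) = 0.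
Proof.
rewrite dot_reject; have [->|b0] := eqVneq (dot b b) 0; first by rewrite !mul0r subr0.
by rewrite mulfK // subrr.
Qed.

Lemma tr_reject m (b : 'cV[R]_m) : (reject b)^T = reject b.
Proof.
by rewrite /reject linearB /= trmx1 linearZ /= trmx_mul trmxK.
Qed.

Lemma gram_det_eq m n (B : 'M[R]_(m, n)) d (f g : 'I_d -> 'I_n) :
  f =1 g -> gram_det B f = gram_det B g.
Proof.
by move=> fg; congr (\det _); apply/matrixP => k l; rewrite !mxE !fg.
Qed.

Lemma gram_det0 m n (B : 'M[R]_(m, n)) (f : 'I_0 -> 'I_n) : gram_det B f = 1.
Proof. by rewrite /gram_det det_mx00. Qed.

Lemma gram_det_perm m n (B : 'M[R]_(m, n)) d (f : 'I_d -> 'I_n) (s : {perm 'I_d}) :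
  gram_det B (f \o s) = gram_det B f.
Proof.
rewrite /gram_det; set M := (X in _ = \det X).
have -> : \matrix_(k, l) dot (col ((f \o s) k) B) (col ((f \o s) l) B) =
  perm_mx s *m M *m (perm_mx s)^T :> 'M[R]_d.
  by apply/matrixP => k l; rewrite -row_permE tr_perm_mx -col_permE !mxE ?invgK.
rewrite !det_mulmx det_tr mulrAC -expr2 det_perm -signr_odd.
by case: odd; rewrite ?expr1 ?sqrrN ?expr1n mul1r.
Qed.

(** Base times height: one step of Gaussian elimination leaves the Schur complement of [dot b b],
    which is the Gram matrix of the columns projected off [b]. *)
Lemma gram_det_rec m n (B : 'M[R]_(m, n)) d (f : 'I_d.+1 -> 'I_n) :
  let b := col (f ord0) B in
  gram_det B f = dot b b * gram_det (reject b *m B) (f \o lift ord0).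
Proof.
move=> b; rewrite /gram_det.
have [b0|b0] := eqVneq (dot b b) 0.
  rewrite b0 mul0r (expand_det_row _ ord0) big1 // => j _.
  move/eqP: b0; rewrite dot_eq0 => /eqP b0; rewrite mxE -/b b0.
  have -> : (0 : 'cV[R]_m) = 0 *: 0 by rewrite scaler0.
  by rewrite dotZl !mul0r.
set M := (X in \det X = _); set M' := (X in _ = _ * \det X).
pose v : 'cV[R]_d := \col_k (dot b (col (f (lift ord0 k)) B)).
have ME : M = block_mx ((dot b b)%:M : 'M[R]_1) v^T v
                (M' + (dot b b)^-1 *: (v *m v^T)) :> 'M[R]_(1 + d).
  apply/matrixP => i j; rewrite [LHS]mxE -(splitK i) -(splitK j).
  have e0 (k : 'I_1) : lshift d k = ord0 by rewrite ord1; apply: val_inj.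
  have e1 (k : 'I_d) : rshift 1 k = lift ord0 k by apply: val_inj.
  case: (fintype.split i) => k; case: (fintype.split j) => l /=.
  - by rewrite block_mxEul !e0 [RHS]mxE !ord1 mulr1n.
  - by rewrite block_mxEur !e0 !e1 !mxE.
  - by rewrite block_mxEdl !e0 !e1 !mxE dotC.
  rewrite block_mxEdr !e1 !mxE big_ord1 !mxE /=.
  by rewrite !col_mulmx dot_reject; ring.
have LE : block_mx (1%:M : 'M[R]_1) 0 (- (dot b b)^-1 *: v) 1%:M *m
    block_mx ((dot b b)%:M : 'M[R]_1) v^T v (M' + (dot b b)^-1 *: (v *m v^T)) =
    block_mx ((dot b b)%:M : 'M[R]_1) v^T 0 M'.
  rewrite mulmx_block !mul1mx !mul0mx !addr0.
  rewrite mul_mx_scalar scalerA mulrN mulfV // scaleN1r addNr.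
  by rewrite -scalemxAl scaleNr addrC addrK.
rewrite ME; have := congr1 determinant LE.
by rewrite det_mulmx det_lblock !det1 !mul1r => ->; rewrite det_ublock det_scalar1.
Qed.

Lemma gram_det_ge0 m n (B : 'M[R]_(m, n)) d (f : 'I_d -> 'I_n) : 0 <= gram_det B f.
Proof.
elim: d B f => [|d IH] B f; first by rewrite gram_det0.
by rewrite gram_det_rec mulr_ge0 ?dot_ge0.
Qed.

Lemma gram_det_scale m n p (B : 'M[R]_(m, n)) (W : 'M[R]_(m, p)) d
    (f : 'I_d -> 'I_n) (g : 'I_d -> 'I_p) (a : 'I_d -> R) :
  (forall k, col (g k) W = a k *: col (f k) B) ->
  gram_det W g = (\prod_k a k) ^+ 2 * gram_det B f.
Proof.
move=> aE; rewrite /gram_det; set M := (X in _ = _ * \det X).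
have -> : \matrix_(k, l) dot (col (g k) W) (col (g l) W) =
    diag_mx (\row_k a k) *m M *m diag_mx (\row_k a k) :> 'M[R]_d.
  apply/matrixP => k l; rewrite mul_mx_diag mul_diag_mx !mxE !aE.
  by rewrite dotZl dotZr mulrAC mulrA mulrC mulrA.
rewrite !det_mulmx det_diag mulrAC -expr2; congr (_ ^+ 2 * _).
by apply: eq_bigr => k _; rewrite mxE.
Qed.

Definition hs2 m n (B : 'M[R]_(m, n)) : R := \sum_i dot (col i B) (col i B).

Definition gram_sum m n (B : 'M[R]_(m, n)) d : R :=
  \sum_(f : {ffun 'I_d -> 'I_n}) gram_det B f.

Lemma hs2_ge0 m n (B : 'M[R]_(m, n)) : 0 <= hs2 B.
Proof. by rewrite sumr_ge0 // => i _; rewrite dot_ge0. Qed.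

(** Column [i] is projected to zero and no other grows. Hence the factor [expR (dot b b)] paid for
    eliminating a column is available in [expR (hs2 B)]. *)
Lemma hs2_reject m n (B : 'M[R]_(m, n)) (i : 'I_n) :
  hs2 (reject (col i B) *m B) <= hs2 B - dot (col i B) (col i B).
Proof.
rewrite /hs2 (bigD1 i) //= (bigD1 i (F := fun j => dot (col j B) _)) //=.
rewrite col_mulmx reject_self add0r addrC addrK.
by apply: ler_sum => j _; rewrite col_mulmx dot_reject_le.
Qed.

Lemma dot_trmx m n (B : 'M[R]_(m, n)) (x : 'cV[R]_m) :
  dot (B^T *m x) (B^T *m x) = \sum_i dot x (col i B) ^+ 2.
Proof.
rewrite dotE; apply: eq_bigr => i _; rewrite -expr2; congr (_ ^+ 2).
by rewrite mxE dotE; apply: eq_bigr => k _; rewrite !mxE mulrC.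
Qed.

(** The mass lost is [|B^T b|^2 / |b|^2], and nothing is lost when [b = 0]. *)
Lemma hs2_reject_ge m n (B : 'M[R]_(m, n)) (b : 'cV[R]_m) (tau : R) :
  0 <= tau -> (forall x, dot (B^T *m x) (B^T *m x) <= tau * dot x x) ->
  hs2 B - tau <= hs2 (reject b *m B).
Proof.
move=> tau0 tauB.
have -> : hs2 (reject b *m B) = hs2 B - dot (B^T *m b) (B^T *m b) / dot b b.
  rewrite dot_trmx mulr_suml -sumrB; apply: eq_bigr => i _.
  by rewrite col_mulmx dot_reject expr2.
rewrite lerB //; have [->|b0] := eqVneq (dot b b) 0; first by rewrite invr0 mulr0.
by rewrite ler_pdivrMr ?tauB // lt_def b0 dot_ge0.
Qed.

Lemma gram_sum_marg0 m n (B : 'M[R]_(m, n)) d (i : 'I_n) :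
  \sum_(f : {ffun 'I_d.+1 -> 'I_n} | f ord0 == i) gram_det B f =
  dot (col i B) (col i B) * gram_sum (reject (col i B) *m B) d.
Proof.
pose cons (h : {ffun 'I_d -> 'I_n}) : {ffun 'I_d.+1 -> 'I_n} :=
  [ffun k => if unlift ord0 k is Some l then h l else i].
pose tl (f : {ffun 'I_d.+1 -> 'I_n}) : {ffun 'I_d -> 'I_n} :=
  [ffun l => f (lift ord0 l)].
rewrite (reindex_onto cons tl) /=; last first.
  move=> f /eqP fi; apply/ffunP => k; rewrite ffunE.
  by case: unliftP => [l ->|->]; rewrite ?ffunE.
rewrite mulr_sumr; apply: eq_big => [h|h _].
  rewrite ffunE unlift_none eqxx /=; apply/eqP/ffunP => l.
  by rewrite !ffunE liftK.
rewrite gram_det_rec ffunE unlift_none; congr (_ * _).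
by apply: gram_det_eq => l /=; rewrite ffunE liftK.
Qed.

(** The Gram determinant is symmetric in the tuple, so a transposition moves position [k] to
    position [0]. Divided by [gram_sum], this is the chance that position [k] of the random tuple
    shows column [i]. *)
Lemma gram_sum_marg m n (B : 'M[R]_(m, n)) d (i : 'I_n) (k : 'I_d.+1) :
  \sum_(f : {ffun 'I_d.+1 -> 'I_n} | f k == i) gram_det B f =
  dot (col i B) (col i B) * gram_sum (reject (col i B) *m B) d.
Proof.
rewrite -gram_sum_marg0.
pose sw (f : {ffun 'I_d.+1 -> 'I_n}) : {ffun 'I_d.+1 -> 'I_n} :=
  [ffun l => f (tperm ord0 k l)].
have swK : involutive sw by move=> f; apply/ffunP => l; rewrite !ffunE tpermK.
rewrite (reindex_inj (inv_inj swK)) /=.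
apply: eq_big => [f|f _]; first by rewrite ffunE tpermR.
rewrite -(gram_det_perm B f (tperm ord0 k)).
by apply: gram_det_eq => l /=; rewrite ffunE.
Qed.

Lemma gram_sum_rec m n (B : 'M[R]_(m, n)) d :
  gram_sum B d.+1 =
  \sum_i dot (col i B) (col i B) * gram_sum (reject (col i B) *m B) d.
Proof.
under [RHS]eq_bigr do rewrite -gram_sum_marg0.
by rewrite /gram_sum (partition_big (fun f : {ffun 'I_d.+1 -> 'I_n} => f ord0) predT).
Qed.

Lemma gram_sum0 m n (B : 'M[R]_(m, n)) : gram_sum B 0 = 1.
Proof.
rewrite /gram_sum (eq_bigr (fun=> 1)) => [|f _]; last by rewrite gram_det0.
by rewrite sumr_const card_ffun !card_ord expn0.
Qed.

Lemma gram_sumZ m n (B : 'M[R]_(m, n)) d a :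
  gram_sum (a *: B) d = a ^+ d ^+ 2 * gram_sum B d.
Proof.
rewrite /gram_sum mulr_sumr; apply: eq_bigr => f _.
rewrite (@gram_det_scale _ _ _ B (a *: B) d f f (fun=> a)); last first.
  by move=> k; apply/matrixP => i j; rewrite !mxE.
by rewrite prodr_const card_ord.
Qed.

(* Adding one index to a tuple spanning a space of dimension at most d multiplies
   the total Gram determinant by the squared Hilbert-Schmidt norm off that space,
   which is at least [hs2 B - d * tau]. *)
Lemma gram_sum_ge m n (B : 'M[R]_(m, n)) d (tau L : R) :
  0 <= tau -> 0 <= L ->
  (forall x, dot (B^T *m x) (B^T *m x) <= tau * dot x x) ->
  (forall k, (k < d)%N -> L <= hs2 B - k%:R * tau) -> L ^+ d <= gram_sum B d.
Proof.
move=> tau0 L0; elim: d B => [|d IH] B tauB hB; first by rewrite gram_sum0.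
have Bd b : L ^+ d <= gram_sum (reject b *m B) d.
  apply: IH => [x|k kd].
    rewrite trmx_mul tr_reject -mulmxA (le_trans (tauB _)) //.
    by rewrite ler_wpM2l // dot_reject_le.
  apply: le_trans (hB k.+1 kd) _; rewrite -natr1 mulrDl mul1r opprD addrA addrAC.
  by rewrite lerB // hs2_reject_ge.
rewrite gram_sum_rec exprS.
apply: (@le_trans _ _ (hs2 B * L ^+ d)).
  rewrite ler_wpM2r ?exprn_ge0 //; have := hB 0%N erefl; rewrite mul0r subr0 //.
rewrite mulr_suml; apply: ler_sum => i _; rewrite ler_wpM2l ?dot_ge0 //.
Qed.

End Gram.

(** * Finitely supported variables *)

Lemma sum_half_le (R : realFieldType) L : \sum_(j < L) (2^-1 : R) ^+ j <= 2.
Proof.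
suff -> : \sum_(j < L) (2^-1 : R) ^+ j = 2 - 2 * 2^-1 ^+ L.
  by rewrite lerBlDr lerDl mulr_ge0 ?exprn_ge0.
elim: L => [|L IH]; first by rewrite big_ord0 expr0 mulr1 subrr.
by rewrite big_ord_recr /= IH exprS; field.
Qed.

(** Take [j] least with [|y| <= 2 ^ j]. Its summand alone suffices: for [j > 0] one has
    [y ^ 2 > 4 ^ (j - 1)], and [expR (- s) <= s^-1]. *)
Lemma expR_sqr_bound (R : realType) (y : R) L : `|y| <= 2 ^+ L ->
  expR (- (y ^+ 2 / 4)) <= \sum_(j < L.+1 | `|y| <= 2 ^+ j) 16 * 4^-1 ^+ j.
Proof.
move=> yL.
have h : exists j, `|y| <= 2 ^+ j :> R by exists L.
case: (ex_minnP h) => j yj minj.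
have jL : (j < L.+1)%N by rewrite ltnS minj.
rewrite (bigD1 (Ordinal jL)) //= -[leLHS]addr0; apply: lerD; last first.
  by apply: sumr_ge0 => k _; rewrite mulr_ge0 ?exprn_ge0.
case: j yj minj {jL} => [|j] yj minj.
  by rewrite expr0 mulr1 (@le_trans _ _ 1) ?expR_le1 // ?oppr_le0; [rewrite divr_ge0 ?sqr_ge0|lra].
have yj' : 2 ^+ j < `|y|.
  by rewrite ltNge; apply/negP => /minj; rewrite ltnn.
have y0 : 0 < y ^+ 2 by rewrite -real_normK ?num_real // exprn_gt0 // (lt_trans _ yj') ?exprn_gt0.
have jy : 4 ^+ j <= y ^+ 2.
  have -> : (4 : R) ^+ j = (2 ^+ j) ^+ 2 by rewrite -exprM mulnC exprM; congr (_ ^+ _); ring.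
  by rewrite -(@real_normK _ y) ?num_real // lerXn2r ?nnegrE ?exprn_ge0 // ltW.
rewrite expRN.
apply: (@le_trans _ _ (y ^+ 2 / 4)^-1).
  rewrite lef_pV2 ?posrE ?expR_gt0 ?divr_gt0 //.
  by apply: le_trans (expR_ge1Dx _); rewrite lerDr.
rewrite invf_div ler_pdivrMr // exprVn.
have := exprn_gt0 j (ltr0Sn R 3); set w := 4 ^+ j in jy *; move=> w0.
rewrite -(ler_pM2r w0).
have -> : 16 / 4 ^+ j.+1 * y ^+ 2 * w = 4 * y ^+ 2.
  by rewrite exprS -/w; field; rewrite gt_eqF.
by rewrite ler_pM2l.
Qed.

Section OneVariable.
Variables (R : realType) (S : finType) (p x : S -> R) (q : R).
Hypothesis p0 : forall s, 0 <= p s.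
Hypothesis conc : forall v, \sum_(s | `|x s - v| <= 1) p s <= q.

Lemma conc_ge0 : 0 <= q.
Proof. by apply: le_trans (conc 0); exact: sumr_ge0. Qed.

(** Cut into pieces of length 2. The count is [k.+1] because the degenerate interval [k = 0] already
    costs one [q]. *)
Lemma conc_interval (v : R) k :
  \sum_(s | v <= x s <= v + 2 * k%:R) p s <= k.+1%:R * q.
Proof.
have sub (P Q : pred S) : (forall s, P s -> Q s) -> \sum_(s | P s) p s <= \sum_(s | Q s) p s.
  move=> PQ; rewrite [leRHS](bigID P) /= [X in _ <= X + _](eq_bigl P).
    by rewrite lerDl sumr_ge0.
  by move=> s; case Ps: (P s); rewrite ?andbF // PQ.
elim: k v => [|k IH] v.
  rewrite mul1r; apply: le_trans (conc v); apply: sub => s /andP[vx xv].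
  by rewrite ler_norml; lra.
apply: (@le_trans _ _ (\sum_(s | v <= x s <= v + 2) p s +
    \sum_(s | v + 2 <= x s <= v + 2 + 2 * k%:R) p s)).
  rewrite (bigID (fun s => x s <= v + 2)) /=; apply: lerD; apply: sub => s.
    by case/andP=> /andP[-> _] ->.
  rewrite -ltNge -natr1 => /andP[/andP[_ h] /ltW ->] /=.
  by apply: le_trans h _; lra.
have -> : k.+2%:R * q = q + k.+1%:R * q by rewrite -(natr1 k.+1); ring.
apply: lerD; last exact: IH.
apply: le_trans (conc (v + 1)); apply: sub => s /andP[vx xv].
by rewrite ler_norml; lra.
Qed.

Lemma conc_scaled (a v r : R) : 0 < a -> 0 <= r ->
  \sum_(s | `|a * x s + v| <= r) p s <= (r / a + 2) * q.
Proof.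
move=> a0 r0; pose k := (Num.truncn (r / a)).+1.
have ra0 : 0 <= r / a by rewrite divr_ge0 // ltW.
have /andP[k1 k2] := truncn_itv ra0.
have kle : k.+1%:R <= r / a + 2 by rewrite /k -!natr1; lra.
apply: le_trans (ler_wpM2r conc_ge0 kle).
apply: le_trans (conc_interval (- v / a - k%:R) k).
rewrite [leRHS](bigID (fun s => `|a * x s + v| <= r)) /=.
rewrite [X in _ <= X + _](eq_bigl (fun s => `|a * x s + v| <= r)).
  by rewrite lerDl sumr_ge0.
move=> s; apply/andP/idP => [[]//|h]; split => //.
move: h; rewrite ler_norml => /andP[h1 h2].
have e : x s = (a * x s + v) / a - v / a by field; rewrite gt_eqF.
have : (a * x s + v) / a <= r / a by rewrite ler_pM2r ?invr_gt0.
have : - (r / a) <= (a * x s + v) / a by rewrite -mulNr ler_pM2r ?invr_gt0.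
move: k2; rewrite -/k => k2 h3 h4; rewrite {1 2}e mulNr; apply/andP; split; lra.
Qed.

(** Layer [j] has weight of order [4 ^ - j] and mass of order [2 ^ j * q * (1 + a^-1)], so the
    layers sum as a geometric series. *)
Lemma conc_gauss (a v : R) : 0 < a ->
  \sum_s p s * expR (- ((a * x s + v) ^+ 2 / 4)) <= 64 * q * (1 + a^-1).
Proof.
move=> a0.
have [L hL] : exists L : nat, forall s : S, `|a * x s + v| <= 2 ^+ L :> R.
  exists (\max_s Num.truncn (`|a * x s + v|%R)).+1 => s.
  have /andP[_ /ltW h] := truncn_itv (normr_ge0 (a * x s + v)).
  apply: le_trans h _; rewrite -natrX ler_nat.
  apply: leq_trans (ltnW (ltn_expl _ (isT : (1 < 2)%N))); rewrite ltnS.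
  exact: (leq_bigmax (F := fun s => Num.truncn (`|a * x s + v|%R)) s).
apply: (@le_trans _ _ (\sum_s \sum_(j < L.+1)
    if `|a * x s + v| <= 2 ^+ j then p s * (16 * 4^-1 ^+ j) else 0)).
  apply: ler_sum => s _; rewrite -big_mkcond -mulr_sumr ler_wpM2l //.
  exact: expR_sqr_bound.
rewrite exchange_big /=.
apply: (@le_trans _ _ (\sum_(j < L.+1) (32 * q * (1 + a^-1)) * 2^-1 ^+ j)); last first.
  have -> : 64 * q * (1 + a^-1) = 32 * q * (1 + a^-1) * 2 by ring.
  rewrite -mulr_sumr ler_wpM2l ?sum_half_le //.
  by rewrite !mulr_ge0 ?conc_ge0 // addr_ge0 // invr_ge0 ltW.
apply: ler_sum => j _; rewrite -big_mkcond -mulr_suml.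
apply: (@le_trans _ _ ((2 ^+ j / a + 2) * q * (16 * 4^-1 ^+ j))).
  by apply: ler_wpM2r; [rewrite mulr_ge0 ?exprn_ge0|apply: conc_scaled; rewrite ?exprn_ge0].
have -> : (4 : R)^-1 ^+ j = 2^-1 ^+ j * 2^-1 ^+ j by rewrite -exprMn; congr (_ ^+ _); field.
have e : 2 ^+ j * 2^-1 ^+ j = 1 :> R by rewrite -exprMn divff ?expr1n.
rewrite (_ : (_ + 2) * q * _ =
  16 * q * (2 ^+ j * 2^-1 ^+ j / a + 2 * 2^-1 ^+ j) * 2^-1 ^+ j); last by ring.
rewrite e ler_wpM2r ?exprn_ge0 // (_ : 32 * q = 16 * q * 2); last by ring.
rewrite -[leRHS]mulrA ler_wpM2l ?mulr_ge0 ?conc_ge0 //.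
have : 2^-1 ^+ j <= 1 :> R by rewrite exprn_ile1 //; lra.
have : 0 < a^-1 by rewrite invr_gt0.
lra.
Qed.

End OneVariable.

(** * Independent finite laws, and elimination of columns one at a time *)

Section FiniteModel.
Variables (R : realType) (S : finType) (n : nat).
Variables (p x : 'I_n -> S -> R) (q : R).
Hypothesis p0 : forall i s, 0 <= p i s.
Hypothesis p1 : forall i, \sum_s p i s = 1.
Hypothesis conc : forall i v, \sum_(s | `|x i s - v| <= 1) p i s <= q.

Definition weight (F : {ffun 'I_n -> S}) : R := \prod_i p i (F i).

Definition value (F : {ffun 'I_n -> S}) : 'cV[R]_n := \col_i x i (F i).

Definition gauss_mean m (al : R) (B : 'M[R]_(m, n)) (u : 'cV[R]_m) : R :=
  \sum_F weight F * expR (- (al * dot (B *m value F - u) (B *m value F - u))).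

Definition update (F : {ffun 'I_n -> S}) i s : {ffun 'I_n -> S} :=
  [ffun k => if k == i then s else F k].

Lemma weight_ge0 F : 0 <= weight F.
Proof. by apply: prodr_ge0. Qed.

Lemma sum_weight : \sum_F weight F = 1.
Proof.
rewrite /weight -(bigA_distr_bigA (fun i s => p i s)) big1 // => i _; exact: p1.
Qed.

(** Exchanging [F i] with a fresh independent label is an involution preserving the joint weight.
    This plays the part of conditioning on the other coordinates. *)
Lemma sum_weight_resample i (h : {ffun 'I_n -> S} -> R) :
  \sum_F weight F * h F = \sum_F weight F * \sum_s p i s * h (update F i s).
Proof.
pose sw (Fs : {ffun 'I_n -> S} * S) := (update Fs.1 i Fs.2, Fs.1 i).
have swK : involutive sw.
  move=> [F s]; rewrite /sw /=; congr pair; last by rewrite ffunE eqxx.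
  by apply/ffunP => k; rewrite !ffunE; case: eqP => // ->.
under [RHS]eq_bigr do rewrite mulr_sumr.
rewrite pair_big /= (reindex_inj (inv_inj swK)) /=.
transitivity (\sum_(Fs : {ffun 'I_n -> S} * S) weight Fs.1 * (p i Fs.2 * h Fs.1)).
  rewrite -(pair_big predT predT (fun F s => weight F * (p i s * h F))) /=.
  by apply: eq_bigr => F _; rewrite -mulr_sumr -mulr_suml p1 mul1r.
apply: eq_bigr => -[F s] _ /=.
have -> : update (update F i s) i (F i) = F.
  by apply/ffunP => k; rewrite !ffunE; case: eqP => // ->.
rewrite !mulrA; congr (_ * _); rewrite /weight (bigD1 i) //= [in RHS](bigD1 i) //=.
rewrite ffunE eqxx mulrAC [RHS]mulrC mulrA; congr (_ * _ * _).
by apply: eq_bigr => k /negbTE ki; rewrite ffunE ki.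
Qed.

Lemma value_update F i s :
  value (update F i s) = \col_k (if k == i then 0 else x k (F k)) + x i s *: delta_mx i 0.
Proof.
apply/matrixP => k j; rewrite ord1 !mxE ffunE eqxx andbT.
by case: eqP => [->|_]; rewrite ?mulr1 ?add0r ?mulr0 ?addr0.
Qed.

Lemma gauss_mean_ge0 m al (B : 'M[R]_(m, n)) u : 0 <= gauss_mean al B u.
Proof. by apply: sumr_ge0 => F _; rewrite mulr_ge0 ?weight_ge0 ?expR_ge0. Qed.

Lemma gauss_mean_le1 m al (B : 'M[R]_(m, n)) u : 0 <= al -> gauss_mean al B u <= 1.
Proof.
move=> al0; rewrite -sum_weight; apply: ler_sum => F _.
by rewrite ler_piMr ?weight_ge0 // expR_le1 oppr_le0 mulr_ge0 ?dot_ge0.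
Qed.

(* Averaging over the i-th coordinate only: it moves [B X] along the i-th column,
   so it does not affect the component orthogonal to that column. *)
Lemma gauss_mean_reject m al (B : 'M[R]_(m, n)) u (b : 'cV[R]_m) i : 4^-1 <= al ->
  b = col i B ->
  Num.sqrt (dot b b) * gauss_mean al B u <=
    128 * q * expR (dot b b) * gauss_mean al (reject b *m B) (reject b *m u).
Proof.
move=> al4 bE; have q0 : 0 <= q := conc_ge0 (p0 i) (conc i).
have [b0|b0] := eqVneq (dot b b) 0.
  by rewrite b0 sqrtr0 mul0r !mulr_ge0 ?expR_ge0 ?gauss_mean_ge0.
have bp : 0 < dot b b by rewrite lt_def b0 dot_ge0.
set a := Num.sqrt (dot b b); have a0 : 0 < a by rewrite sqrtr_gt0.
have a2 : a ^+ 2 = dot b b by rewrite sqr_sqrtr ?dot_ge0.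
rewrite /gauss_mean (sum_weight_resample i) !mulr_sumr; apply: ler_sum => F _.
rewrite (mulrCA a) (mulrCA (128 * q * _)) ler_wpM2l ?weight_ge0 //.
set z := B *m (\col_k (if k == i then 0 else x k (F k))) - u.
have zE s : B *m value (update F i s) - u = z + x i s *: b.
  by rewrite value_update mulmxDr -scalemxAr -colE -bE addrAC.
clearbody z; have Qb : reject b *m b = 0 by apply/eqP; rewrite -dot_eq0 reject_self.
have QzE s : reject b *m B *m value (update F i s) - reject b *m u = reject b *m z.
  by rewrite -mulmxA -mulmxBr zE mulmxDr -scalemxAr Qb scaler0 addr0.
have FE : F = update F i (F i) by apply/ffunP => k; rewrite ffunE; case: eqP => // ->.
rewrite [in leRHS]FE QzE; set D := dot (reject b *m z) _.
(* Pythagoras: [D] is the part orthogonal to [b], and the part along [b] is affine in [x i s] with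
   slope [a = |b|]. *)
have split2 s : dot (z + x i s *: b) (z + x i s *: b) = D + (a * x i s + dot b z / a) ^+ 2.
  rewrite /D dot_reject !(dotDl, dotDr, dotZl, dotZr) (dotC z b).
  rewrite sqrrD exprMn a2 expr_div_n a2.
  have -> : a * x i s * (dot b z / a) = x i s * dot b z by field; rewrite gt_eqF.
  by field.
have -> : 128 * q * expR (dot b b) * expR (- (al * D)) =
   expR (- (al * D)) * (128 * q * expR (dot b b)) by rewrite mulrC.
apply: (@le_trans _ _ (a * (expR (- (al * D)) * (64 * q * (1 + a^-1))))).
  rewrite ler_pM2l //.
  apply: (@le_trans _ _ (expR (- (al * D)) *
     \sum_s p i s * expR (- ((a * x i s + dot b z / a) ^+ 2 / 4)))).
    rewrite mulr_sumr; apply: ler_sum => s _; rewrite mulrCA ler_wpM2l //.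
    rewrite zE split2 mulrDr opprD expRD ler_wpM2l ?expR_ge0 // ler_expR lerN2.
    by rewrite mulrC ler_wpM2r ?sqr_ge0.
  by rewrite ler_wpM2l ?expR_ge0 // conc_gauss.
rewrite mulrCA ler_wpM2l ?expR_ge0 //.
have -> : a * (64 * q * (1 + a^-1)) = 64 * q * (1 + a) by field; rewrite gt_eqF.
(* [1 + a <= 2 * expR (a ^ 2)] makes the bound uniform in the length of the column. *)
rewrite (_ : 128 * q * _ = 64 * q * (2 * expR (dot b b))); last by ring.
rewrite ler_wpM2l ?mulr_ge0 //.
have := expR_ge1Dx (dot b b); rewrite -a2; nra.
Qed.

(** Eliminating the columns of the tuple in turn collects the successive heights, whose product is
    the square root of the Gram determinant; the mean that remains is at most 1. *)
Lemma gauss_mean_gram_det m al (B : 'M[R]_(m, n)) u d (f : 'I_d -> 'I_n) : 4^-1 <= al ->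
  Num.sqrt (gram_det B f) * gauss_mean al B u <=
  (128 * q) ^+ d * expR (\sum_k dot (col (f k) B) (col (f k) B)).
Proof.
move=> al4; have al0 : 0 <= al by apply: le_trans al4; rewrite invr_ge0.
elim: d B u f => [|d IH] B u f.
  by rewrite gram_det0 sqrtr1 mul1r big_ord0 expR0 expr0 mulr1 gauss_mean_le1.
have q0 : 0 <= q := conc_ge0 (p0 (f ord0)) (conc (f ord0)).
rewrite gram_det_rec sqrtrM ?dot_ge0 // mulrAC mulrC.
set b := col (f ord0) B; set g := Num.sqrt (gram_det _ _).
apply: (@le_trans _ _ (g * (128 * q * expR (dot b b) *
    gauss_mean al (reject b *m B) (reject b *m u)))).
  by rewrite ler_wpM2l ?sqrtr_ge0 // (gauss_mean_reject _ (i := f ord0)).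
rewrite mulrCA big_ord_recl expRD exprS.
rewrite [leRHS]mulrACA ler_wpM2l ?mulr_ge0 ?expR_ge0 //.
apply: le_trans (IH _ _ _) _; rewrite ler_wpM2l ?exprn_ge0 ?mulr_ge0 // ler_expR.
by apply: ler_sum => k _; rewrite col_mulmx dot_reject_le.
Qed.

End FiniteModel.

(** * Characteristic functions *)

Section CosineBounds.
Variable R : realType.

Lemma sin_eq_cos_mul (t : R) : 0 <= t -> exists2 c, 0 <= c <= t & sin t = cos c * t.
Proof.
move=> t0.
have h0 : {within `[0, t], continuous (sin : R -> R)}.
  exact/continuous_subspaceT/continuous_sin.
have [c ct] := MVT_segment t0 (fun x _ => is_derive_sin x) h0.
by rewrite sin0 !subr0 => h; exists c => //; move: ct; rewrite in_itv.
Qed.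

Lemma sin_sqr_le (t : R) : sin t ^+ 2 <= t ^+ 2.
Proof.
wlog t0 : t / 0 <= t => [h|].
  have [/h//|/ltW t0] := leP 0 t.
  by rewrite -sqrrN -sinN -[leRHS]sqrrN h // oppr_ge0.
have [c _ ->] := sin_eq_cos_mul t0; rewrite exprMn ler_piMl ?sqr_ge0 //.
Qed.

Lemma cos_half (y : R) : cos y = 1 - 2 * sin (y / 2) ^+ 2.
Proof.
have {1}-> : y = (y / 2) *+ 2 by rewrite -mulr_natr mulfVK.
by rewrite cos_mulr2n cos2sin2 -mulr_natr; ring.
Qed.

Lemma cos_ge (y : R) : 1 - y ^+ 2 / 2 <= cos y.
Proof.
rewrite cos_half; have := sin_sqr_le (y / 2); rewrite expr_div_n; lra.
Qed.

Lemma cos_le (y : R) : `|y| <= 1 -> cos y <= 1 - y ^+ 2 / 4.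
Proof.
rewrite -cos_norm -(@real_normK _ y) ?num_real //; move: `|y| (normr_ge0 y) => t t0 t1.
rewrite cos_half.
have [c /andP[c0 ct] ->] := @sin_eq_cos_mul (t / 2) (divr_ge0 t0 (ler0n _ 2)).
(* Here [c <= t / 2 <= 1 / 2]; the claim needs [cos c ^ 2 >= 1 / 2], and [9 / 16] is enough. *)
have cc : 3 / 4 <= cos c.
  apply: le_trans (cos_ge c); have : c ^+ 2 <= 2^-1 by nra.
  lra.
have : (3 / 4) ^+ 2 <= cos c ^+ 2 by rewrite lerXn2r ?nnegrE //; lra.
have -> : (cos c * (t / 2)) ^+ 2 = cos c ^+ 2 * t ^+ 2 / 4 by field.
have := sqr_ge0 t; nra.
Qed.

Lemma expRN_sqr_le_cos (y : R) : `|y| <= 1 -> expR (- y ^+ 2) <= cos y.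
Proof.
move=> y1; apply: le_trans (cos_ge y).
have : y ^+ 2 <= 1 by rewrite -(@real_normK _ y) ?num_real // expr_le1.
move: (y ^+ 2) (sqr_ge0 y) => s s0 s1; rewrite expRN.
have h := expR_ge1Dx s.
apply: (@le_trans _ _ (1 + s)^-1); first by rewrite lef_pV2 ?posrE ?expR_gt0 //; lra.
have s2 : 0 < 1 + s by lra.
rewrite -div1r ler_pdivrMr //; nra.
Qed.

Lemma cos_le_expRN (y : R) : `|y| <= 1 -> cos y <= expR (- (y ^+ 2 / 4)).
Proof.
move=> /cos_le h; apply: le_trans h _.
have := expR_ge1Dx (- (y ^+ 2 / 4)); lra.
Qed.

End CosineBounds.

(** * Characteristic functions of finite laws and of random signs *)

Section CharacteristicFunctions.
Variable R : realType.
Local Notation Re := (@complex.Re R).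
Local Notation Im := (@complex.Im R).

Definition cis (y : R) : R[i] := (cos y +i* sin y)%C.

Definition sqnorm (z : R[i]) : R := Re z ^+ 2 + Im z ^+ 2.

Definition charf (S : finType) (p x : S -> R) (y : R) : R[i] :=
  \sum_s (p s)%:C%C * cis (y * x s).

Lemma cis0 : cis 0 = 1.
Proof. by rewrite /cis cos0 sin0. Qed.

Lemma cisD a b : cis (a + b) = cis a * cis b.
Proof.
by apply/eqP; rewrite eq_complex /= cosD sinD addrC; apply/andP; split; apply/eqP; ring.
Qed.

Lemma cis_sum (I : finType) (a : I -> R) : cis (\sum_i a i) = \prod_i cis (a i).
Proof. exact: (big_morph cis cisD cis0). Qed.

Lemma Re_realM a z : Re (a%:C%C * z) = a * Re z.
Proof. by case: z => b c /=; rewrite mul0r subr0. Qed.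

Lemma Re_sum (I : finType) (z : I -> R[i]) : Re (\sum_i z i) = \sum_i Re (z i).
Proof. by apply: (big_morph Re) => // -[a b] [c d]. Qed.

Lemma sqnormM z w : sqnorm (z * w) = sqnorm z * sqnorm w.
Proof. by case: z w => [a b] [c d]; rewrite /sqnorm /=; ring. Qed.

Lemma sqnorm_prod (I : finType) (z : I -> R[i]) :
  sqnorm (\prod_i z i) = \prod_i sqnorm (z i).
Proof.
by apply: (big_morph sqnorm sqnormM); rewrite /sqnorm /= expr1n expr0n addr0.
Qed.

Lemma sqnorm_ge0 z : 0 <= sqnorm z.
Proof. by rewrite addr_ge0 ?sqr_ge0. Qed.

Lemma sqnorm_cis y : sqnorm (cis y) = 1.
Proof. exact: cos2Dsin2. Qed.

Lemma Re_le_sqrt z : Re z <= Num.sqrt (sqnorm z).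
Proof.
apply: le_trans (ler_norm _) _; rewrite -sqrtr_sqr ler_wsqrtr //.
by rewrite lerDl sqr_ge0.
Qed.

Lemma prod_charf (I S : finType) (p x : I -> S -> R) (y : I -> R) :
  \prod_i charf (p i) (x i) (y i) =
  \sum_(F : {ffun I -> S}) (\prod_i p i (F i))%:C%C * cis (\sum_i y i * x i (F i)).
Proof.
rewrite /charf bigA_distr_bigA /=; apply: eq_bigr => F _.
by rewrite big_split /= cis_sum rmorph_prod.
Qed.

Definition sqcharf (S : finType) (p x : S -> R) (y : R) : R :=
  sqnorm (charf p x y).

(** [|phi(y)|^2 = phi(y) * phi(-y)] is the characteristic function of the difference of two
    independent copies. *)
Lemma sqcharfE (S : finType) (p x : S -> R) (y : R) :
  (sqcharf p x y)%:C%C =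
  charf (fun s : S * S => p s.1 * p s.2) (fun s => x s.1 - x s.2) y.
Proof.
have -> : (sqcharf p x y)%:C%C = charf p x y * charf p x (- y).
  rewrite /sqcharf /charf.
  have -> : \sum_s (p s)%:C%C * cis (- y * x s) = (\sum_s (p s)%:C%C * cis (y * x s))^*%C.
    rewrite rmorph_sum; apply: eq_bigr => s _; rewrite rmorphM /= oppr0 mulNr.
    by rewrite /cis cosN sinN.
  case: (\sum_s _) => a b; apply/eqP; rewrite eq_complex /= /sqnorm /=.
  by apply/andP; split; apply/eqP; ring.
rewrite /charf mulr_suml; under eq_bigr do rewrite mulr_sumr.
rewrite pair_big /=; apply: eq_bigr => -[s s'] _ /=.
rewrite mulrBr cisD -mulNr rmorphM /=; ring.
Qed.

Lemma sqcharf_cos (S : finType) (p x : S -> R) (y : R) :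
  sqcharf p x y = \sum_(s : S * S) p s.1 * p s.2 * cos (y * (x s.1 - x s.2)).
Proof.
have := congr1 Re (sqcharfE p x y); rewrite /= /charf Re_sum => ->.
by apply: eq_bigr => s _; rewrite Re_realM.
Qed.

Lemma charf_sign (y : R) :
  charf (fun _ : bool => 2^-1) (fun b => if b then 1 else -1) y = (cos y)%:C%C.
Proof.
rewrite /charf big_bool /= mulr1 mulrN1 /cis cosN sinN.
by apply/eqP; rewrite eq_complex /=; apply/andP; split; apply/eqP; field.
Qed.

Definition sign_vector m N (g : {ffun 'I_m * 'I_N -> bool}) : 'cV[R]_m :=
  \col_k \sum_l (if g (k, l) then 1 else -1) / Num.sqrt N%:R.

(* By the central limit theorem [sign_vector] is nearly Gaussian; this elementary
   substitute for the Gaussian characteristic function holds on a large cube. *)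
Lemma mean_cos_sign_vector m N (z : 'cV[R]_m) : (0 < N)%N ->
  (forall k, `|z k 0| <= Num.sqrt N%:R) ->
  let mean := \sum_(g : {ffun 'I_m * 'I_N -> bool})
    (\prod_(i : 'I_m * 'I_N) 2^-1) * cos (dot (sign_vector g) z) in
  expR (- dot z z) <= mean /\ mean <= expR (- (4^-1 * dot z z)).
Proof.
move=> N0 zN mean.
have sN : 0 < Num.sqrt N%:R :> R by rewrite sqrtr_gt0 ltr0n.
pose y (i : 'I_m * 'I_N) := z i.1 0 / Num.sqrt N%:R.
have y1 i : `|y i| <= 1.
  by rewrite /y normrM normfV (gtr0_norm sN) ler_pdivrMr // mul1r.
(* The mean factorises over the [m * N] independent signs, each contributing one cosine. *)
have -> : mean = \prod_i cos (y i).
  have := prod_charf (fun _ _ => 2^-1) (fun (_ : 'I_m * 'I_N) b => if b then 1 else -1) y.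
  under eq_bigr do rewrite charf_sign.
  rewrite -rmorph_prod /= => /(congr1 Re) /= ->.
  rewrite /mean Re_sum; apply: eq_bigr => g _; rewrite Re_realM; congr (_ * cos _).
  rewrite dotE; under [LHS]eq_bigr do rewrite /sign_vector mxE mulr_suml.
  rewrite pair_bigA /=; apply: eq_bigr => -[k l] _.
  by rewrite /y /= mulrC [X in _ * X]mulrC mulrA.
have zy : dot z z = \sum_i y i ^+ 2.
  have -> : \sum_i y i ^+ 2 = \sum_k \sum_(l < N) y (k, l) ^+ 2.
    by rewrite pair_bigA; apply: eq_bigr => -[k l].
  rewrite dotE; apply: eq_bigr => k _; rewrite /y /= sumr_const card_ord expr_div_n.
  by rewrite sqr_sqrtr ?ler0n // -[RHS]mulr_natr mulfVK ?pnatr_eq0 -?lt0n // expr2.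
rewrite zy -sumrN mulr_sumr -sumrN !expR_sum; split; apply: ler_prod => i _.
  by rewrite expR_ge0 expRN_sqr_le_cos.
rewrite [4^-1 * _]mulrC cos_le_expRN // andbT.
by rewrite (le_trans _ (expRN_sqr_le_cos (y1 i))) ?expR_ge0.
Qed.

End CharacteristicFunctions.

(** * Dilates of the squared characteristic function *)

Section SquaredCharacteristicFunction.
Variables (R : realType) (S : finType) (p x : S -> R).
Hypothesis p0 : forall s, 0 <= p s.
Hypothesis p1 : \sum_s p s = 1.

Lemma sum_pair_weight : \sum_(s : S * S) p s.1 * p s.2 = 1.
Proof.
rewrite -(pair_bigA _ (fun s s' => p s * p s')) /=.
by under eq_bigr do rewrite -mulr_sumr p1 mulr1.
Qed.

Lemma sqcharf_ge0 y : 0 <= sqcharf p x y.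
Proof. exact: sqnorm_ge0. Qed.

Lemma sqcharf_le1 y : sqcharf p x y <= 1.
Proof.
rewrite sqcharf_cos -sum_pair_weight; apply: ler_sum => s _.
by rewrite ler_piMr ?mulr_ge0 // cos_le1.
Qed.

(** [1 - cos (2 v) = 2 * (1 - cos v) * (1 + cos v) <= 4 * (1 - cos v)], averaged over the
    symmetrised law. *)
Lemma sqcharf_double y : 1 - sqcharf p x (2 * y) <= 4 * (1 - sqcharf p x y).
Proof.
have e y' : 1 - sqcharf p x y' =
    \sum_(s : S * S) p s.1 * p s.2 * (1 - cos (y' * (x s.1 - x s.2))).
  rewrite sqcharf_cos -[X in X - _]sum_pair_weight -sumrB.
  by apply: eq_bigr => s _; rewrite [RHS]mulrBr mulr1.
rewrite !e mulr_sumr; apply: ler_sum => s _.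
have -> : 2 * y * (x s.1 - x s.2) = (y * (x s.1 - x s.2)) *+ 2 by rewrite -mulr_natr; ring.
rewrite cos_mulr2n; set c := cos _.
have c1 : c <= 1 := cos_le1 _.
rewrite mulrCA ler_wpM2l ?mulr_ge0 // -mulr_natr; nra.
Qed.

Lemma sqcharf_pow2 y j : 1 - sqcharf p x (2 ^+ j * y) <= 4 ^+ j * (1 - sqcharf p x y).
Proof.
elim: j => [|j IH]; first by rewrite !expr0 !mul1r.
rewrite exprS -mulrA; apply: le_trans (sqcharf_double _) _.
by rewrite exprS -mulrA ler_wpM2l.
Qed.

(* Let j <= J be the last scale with [psi (2 ^ j * y) > 1/2].  Then doubling gives
   [1 - psi y >= 4 ^ -j / 8], so [psi y ^ (1 / (2 c))] is at most of order
   [4 ^ (j - J)], and [psi (2 ^ j * y)] may be inserted for free.  The number L of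
   scales is left arbitrary so that it can be chosen independently of c. *)
Lemma sqcharf_powR_le (c y : R) J L : 0 < c -> c <= 2^-1 -> 4 ^+ J * c <= 1 ->
  (J < L)%N -> 0 < sqcharf p x y ->
  Num.sqrt (sqcharf p x y) <=
  expR (c * ln (\sum_(j < L) 32 * 4^-1 ^+ j * sqcharf p x (2 ^+ J * 2^-1 ^+ j * y))).
Proof.
set psi := sqcharf p x; move=> c0 c2 Jc JL psi0; set F := \sum_(j < L) _.
pose k := (2 * c)^-1; have k0 : 0 < k by rewrite invr_gt0 mulr_gt0.
have k1 : 1 <= k by rewrite invf_ge1 ?mulr_gt0 //; lra.
have kJ : 4 ^+ J <= 2 * k.
  rewrite /k invfM mulrA divff // mul1r -(@ler_pM2r _ c) // mulVf ?gt_eqF //.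
have psi1 : psi y <= 1 := sqcharf_le1 y.
have lnpsi : ln (psi y) <= psi y - 1.
  by have := expR_ge1Dx (ln (psi y)); rewrite lnK ?posrE //; lra.
(* The power [c] of this bound is the claim, since [k * c = 1 / 2] gives the square root of
   [psi y]. *)
suff EF : expR (ln (psi y) * k) <= F.
  rewrite -[leRHS](@ger0_norm R) ?expR_ge0 // -sqrtr_sqr ler_wsqrtr //.
  rewrite -expRM_natl -[leLHS]lnK ?posrE // ler_expR mulr_natl.
  have F0 : 0 < F := lt_le_trans (expR_gt0 _) EF.
  have : ln (psi y) * k <= ln F by rewrite -[leLHS]expRK ler_ln ?posrE ?expR_gt0.
  rewrite -(ler_pM2r (mulr_gt0 (ltr0Sn R 1) c0)) -mulrA mulVf ?gt_eqF ?mulr_gt0 //.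
  by rewrite mulr1 mulrC -mulrA mulr_natl.
have term j : (j <= J)%N -> 32 * 4^-1 ^+ (J - j) * psi (2 ^+ j * y) <= F.
  move=> jJ; have lt : (J - j < L)%N by rewrite (leq_ltn_trans (leq_subr _ _)).
  rewrite /F (bigD1 (Ordinal lt)) //=.
  have -> : 2 ^+ J * 2^-1 ^+ (J - j) = 2 ^+ j :> R.
    by rewrite -{1}(subnK jJ) exprD mulrAC -exprMn divff // expr1n mul1r.
  rewrite lerDl sumr_ge0 // => i _; rewrite !mulr_ge0 ?exprn_ge0 ?sqcharf_ge0 //.
have Ebound (a b : R) : 0 < b -> ln (psi y) <= - b -> 0 <= a ->
    expR (ln (psi y) * a) <= (1 + a * b)^-1.
  move=> b0 h a0; apply: (@le_trans _ _ (expR (- (a * b)))).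
    by rewrite ler_expR -mulrN mulrC ler_wpM2l.
  rewrite expRN lef_pV2 ?posrE ?expR_gt0 ?expR_ge1Dx //.
  by rewrite ltr_pwDl // mulr_ge0 // ltW.
have [h|h] := pselect (exists j, (j <= J)%N && (psi (2 ^+ j * y) <= 2^-1)); last first.
  apply: le_trans (term J (leqnn J)); rewrite subnn expr0 mulr1.
  have : 2^-1 < psi (2 ^+ J * y).
    by rewrite ltNge; apply/negP => h'; apply: h; exists J; rewrite leqnn.
  have : expR (ln (psi y) * k) <= 1 by rewrite expR_le1 pmulr_lle0 //; lra.
  lra.
(* The first scale where [psi] is at most [1 / 2] is [0] or [j.+1]; in the latter case [j] is the
   last good scale. If it is [0], a factor [psi y] is split off the power, which takes [k >= 1],
   that is [c <= 1 / 2]. *)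
case: (ex_minnP h) => -[|j] /andP[jJ psij] minj.
  move: psij; rewrite expr0 mul1r => psij.
  apply: le_trans (term 0%N (leq0n J)); rewrite subn0 expr0 mul1r.
  have -> : ln (psi y) * k = ln (psi y) * (k - 1) + ln (psi y) by ring.
  rewrite expRD lnK ?posrE // ler_wpM2r ?sqcharf_ge0 //.
  apply: (@le_trans _ _ (1 + (k - 1) * 2^-1)^-1).
    by apply: Ebound; lra.
  rewrite exprVn -div1r ler_pdivrMr; last lra.
  rewrite mulrAC ler_pdivlMr ?exprn_gt0 //; lra.
have jJ' : (j <= J)%N := ltnW jJ.
apply: le_trans (term j jJ').
have hj : 2^-1 < psi (2 ^+ j * y).
  rewrite ltNge; apply/negP => h'.
  by have := minj j; rewrite jJ' h' ltnn => /(_ isT).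
have fj : 0 < 4 ^+ j :> R by rewrite exprn_gt0.
have l8 : ln (psi y) <= - (8 * 4 ^+ j)^-1.
  have := sqcharf_pow2 y j.+1; rewrite -/psi (exprS 4) => h1.
  have h2 : 1 <= (8 * 4 ^+ j) * (1 - psi y) by lra.
  have : (8 * 4 ^+ j)^-1 <= 1 - psi y by rewrite -div1r ler_pdivrMr ?mulr_gt0 // mulrC.
  lra.
apply: (@le_trans _ _ (1 + k * (8 * 4 ^+ j)^-1)^-1).
  by apply: Ebound => //; rewrite ?invr_gt0 ?mulr_gt0 // ltW.
apply: (@le_trans _ _ (16 * 4^-1 ^+ (J - j))); last first.
  have : 0 < 4^-1 ^+ (J - j) :> R by rewrite exprn_gt0.
  move: (4^-1 ^+ _) => w w0; nra.
have f4 : 4 ^+ J = 4 ^+ (J - j) * 4 ^+ j :> R by rewrite -exprD subnK.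
have f5 : 0 < 4 ^+ (J - j) :> R by rewrite exprn_gt0.
have kp : 0 < k * (8 * 4 ^+ j)^-1 by rewrite mulr_gt0 ?invr_gt0 ?mulr_gt0.
rewrite exprVn; apply: (@le_trans _ _ (k * (8 * 4 ^+ j)^-1)^-1).
  by rewrite lef_pV2 ?posrE //; lra.
rewrite -div1r ler_pdivrMr //.
have -> : 16 / 4 ^+ (J - j) * (k / (8 * 4 ^+ j)) = 2 * k / (4 ^+ (J - j) * 4 ^+ j).
  by field; rewrite !gt_eqF.
by rewrite -f4 ler_pdivlMr ?exprn_gt0 // mul1r.
Qed.

End SquaredCharacteristicFunction.

(** * Jensen's inequality and the choice of finite parameters *)

Lemma expR_jensen (R : realType) (I : finType) (lam l : I -> R) :
  (forall i, 0 <= lam i) -> \sum_i lam i = 1 ->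
  expR (\sum_i lam i * l i) <= \sum_i lam i * expR (l i).
Proof.
move=> lam0 lam1; set mu := \sum_i lam i * l i.
(* The tangent of [expR] at the mean [mu] lies below the graph. *)
apply: (@le_trans _ _ (\sum_i lam i * (expR mu * (1 + (l i - mu))))); last first.
  apply: ler_sum => i _; rewrite ler_wpM2l //.
  have -> : expR (l i) = expR mu * expR (l i - mu) by rewrite -expRD addrC subrK.
  by rewrite ler_wpM2l ?expR_ge0 ?expR_ge1Dx.
have -> : \sum_i lam i * (expR mu * (1 + (l i - mu))) =
    expR mu * (\sum_i lam i * l i + (1 - mu) * \sum_i lam i).
  by rewrite mulr_sumr -big_split /= mulr_sumr; apply: eq_bigr => i _; ring.
by rewrite lam1 -/mu mulr1 addrC subrK mulr1.
Qed.

Lemma sqrtr_prod (R : realType) (I : finType) (a : I -> R) :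
  (forall i, 0 <= a i) -> Num.sqrt (\prod_i a i) = \prod_i Num.sqrt (a i).
Proof.
move=> a0; pose K (y z : R) := Num.sqrt y = z.
have : K (\prod_i a i) (\prod_i Num.sqrt (a i)).
  by apply: (big_rec2 K) => [|i y z _ h]; rewrite /K ?sqrtr1 // sqrtrM ?a0 // h.
by [].
Qed.

(** This yields the number of signs that brings finitely many vectors into the cube of
    [mean_cos_sign_vector]. Every larger number works too, so several requirements can be met at
    once. *)
Lemma sqrt_nat_bound (R : realType) (I : finType) (h : I -> R) :
  exists N : nat, forall M, (N <= M)%N -> forall i, `|h i| <= Num.sqrt M%:R.
Proof.
exists (Num.truncn (\sum_i h i ^+ 2)).+1 => M NM i.
rewrite -sqrtr_sqr ler_wsqrtr //.
have h0 : 0 <= \sum_i h i ^+ 2 by apply: sumr_ge0 => j _; rewrite sqr_ge0.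
have /andP[_ /ltW h1] := truncn_itv h0.
apply: (@le_trans _ _ (\sum_i h i ^+ 2)).
  by rewrite (bigD1 i) //= lerDl sumr_ge0 // => j _; rewrite sqr_ge0.
by apply: le_trans h1 _; rewrite ler_nat.
Qed.

(** [J] is the integer part of the base 4 logarithm of [1 / c], so [2 ^ J] stands in for
    [1 / Num.sqrt c]. *)
Lemma pow4_bracket (R : realType) (c : R) : 0 < c -> c <= 1 ->
  exists J, 4 ^+ J * c <= 1 /\ 1 < 4 ^+ J.+1 * c.
Proof.
move=> c0 c1.
have ex : exists J, 1 < 4 ^+ J.+1 * c.
  exists (Num.truncn c^-1).+1.
  have c' : 0 <= c^-1 by rewrite invr_ge0 ltW.
  have /andP[_ h] := truncn_itv c'.
  rewrite -(ltr_pM2r c0) mulVf ?gt_eqF // in h; apply: lt_le_trans h _.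
  rewrite ler_pM2r // -natrX ler_nat; apply: ltnW; apply: ltn_trans (ltn_expl _ (isT : (1 < 4)%N)).
  by [].
case: (ex_minnP ex) => -[|J] hJ minJ; first by exists 0%N; rewrite expr0 mul1r.
exists J.+1; split => //; rewrite leNgt; apply/negP => h.
by have := minJ J h; rewrite ltnn.
Qed.

(** * Passage between Gaussian means and integrals of characteristic functions *)

Section FourierBounds.
Variables (R : realType) (S : finType) (n : nat).
Variables (p x : 'I_n -> S -> R) (q : R).
Hypothesis p0 : forall i s, 0 <= p i s.
Hypothesis p1 : forall i, \sum_s p i s = 1.
Hypothesis conc : forall i v, \sum_(s | `|x i s - v| <= 1) p i s <= q.

Local Notation psi i := (sqcharf (p i) (x i)).

Definition sign_weight m N : R := \prod_(i : 'I_m * 'I_N) 2^-1.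

Lemma sign_weight_ge0 m N : 0 <= sign_weight m N.
Proof. by apply: prodr_ge0. Qed.

Lemma dot_mulmx_value m (B : 'M[R]_(m, n)) (g : 'cV[R]_m) F :
  dot g (B *m value x F) = \sum_i dot g (col i B) * x i (F i).
Proof.
rewrite dot_mulmx dotE; apply: eq_bigr => i _; rewrite !mxE; congr (_ * _).
by rewrite dotE; apply: eq_bigr => k _; rewrite !mxE mulrC.
Qed.

(** Once the Gaussian is bounded by a mean of characters, independence turns the expectation over
    [F] into a product of characteristic functions; [u] enters only through a phase of modulus 1. *)
Lemma gauss_mean_le_charf m N (B : 'M[R]_(m, n)) u : (0 < N)%N ->
  (forall F k, `|(B *m value x F - u) k 0| <= Num.sqrt N%:R) ->
  gauss_mean p x 1 B u <= \sum_(g : {ffun 'I_m * 'I_N -> bool})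
    sign_weight m N * \prod_i Num.sqrt (psi i (dot (sign_vector R g) (col i B))).
Proof.
move=> N0 zN.
apply: (@le_trans _ _ (\sum_F weight p F * \sum_(g : {ffun 'I_m * 'I_N -> bool})
    sign_weight m N * cos (dot (sign_vector R g) (B *m value x F - u)))).
  apply: ler_sum => F _; rewrite ler_wpM2l ?weight_ge0 // mul1r.
  by have [] := mean_cos_sign_vector N0 (zN F).
under eq_bigr do rewrite mulr_sumr; rewrite exchange_big /=.
apply: ler_sum => g _; under eq_bigr do rewrite mulrCA.
rewrite -mulr_sumr ler_wpM2l ?sign_weight_ge0 //.
set gv := sign_vector R g.
have -> : \prod_i Num.sqrt (psi i (dot gv (col i B))) =
   Num.sqrt (sqnorm (cis (- dot gv u) * \prod_i charf (p i) (x i) (dot gv (col i B)))).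
  rewrite sqnormM sqnorm_cis mul1r sqnorm_prod.
  by rewrite sqrtr_prod // => i; rewrite sqnorm_ge0.
rewrite prod_charf; apply: le_trans (Re_le_sqrt _).
rewrite mulr_sumr Re_sum; apply: ler_sum => F _.
by rewrite mulrCA -cisD Re_realM /= dotBr dot_mulmx_value [- _ + _]addrC.
Qed.

(* The law of the symmetrised variable [X_i - X_i'], whose characteristic function is
   [psi i]. *)
Definition pair_weight d (f : 'I_d -> 'I_n) (k : 'I_d) (s : S * S) : R :=
  p (f k) s.1 * p (f k) s.2.

Definition pair_value d (f : 'I_d -> 'I_n) (k : 'I_d) (s : S * S) : R :=
  x (f k) s.1 - x (f k) s.2.

(** Given the second copy, the difference is a translate of the first. *)
Lemma pair_conc d (f : 'I_d -> 'I_n) k v :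
  \sum_(s | `|pair_value f k s - v| <= 1) pair_weight f k s <= q.
Proof.
rewrite big_mkcond /= -(pair_bigA _ (fun s s' =>
  if `|pair_value f k (s, s') - v| <= 1 then pair_weight f k (s, s') else 0)) /=.
rewrite exchange_big /=.
have -> : q = (\sum_s p (f k) s) * q by rewrite p1 mul1r.
rewrite mulr_suml; apply: ler_sum => s' _.
apply: le_trans (ler_wpM2l (p0 (f k) s') (conc (f k) (x (f k) s' + v))).
rewrite mulr_sumr [leRHS]big_mkcond /= ; apply: ler_sum => s _.
by rewrite /pair_value /pair_weight /= opprD addrA [p _ s' * _]mulrC.
Qed.

(** The way back, by the upper bound in [mean_cos_sign_vector]: the product is the joint
    characteristic function of symmetrised variables. The Gaussian obtained has parameter [4^-1]
    instead of [1], hence the argument [al] of [gauss_mean]. *)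
Lemma sum_sqcharf_le m N d (f : 'I_d -> 'I_n) (W : 'M[R]_(m, d)) : (0 < N)%N ->
  (forall H k, `|(W *m value (pair_value f) H) k 0| <= Num.sqrt N%:R) ->
  Num.sqrt (gram_det W id) * (\sum_(g : {ffun 'I_m * 'I_N -> bool})
    sign_weight m N * \prod_k psi (f k) (dot (sign_vector R g) (col k W)))
  <= (128 * q) ^+ d * expR (\sum_k dot (col k W) (col k W)).
Proof.
move=> N0 WN.
have pp0 k s : 0 <= pair_weight f k s by rewrite mulr_ge0.
have pp1 k : \sum_s pair_weight f k s = 1 by rewrite /pair_weight sum_pair_weight.
apply: le_trans (gauss_mean_gram_det pp0 pp1 (pair_conc f) W 0 id (lexx 4^-1)).
rewrite ler_wpM2l ?sqrtr_ge0 //.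
have psiE gv : \prod_k psi (f k) (dot gv (col k W)) =
    \sum_H weight (pair_weight f) H * cos (dot gv (W *m value (pair_value f) H)).
  have : (\prod_k psi (f k) (dot gv (col k W)))%:C%C =
      \prod_k charf (pair_weight f k) (pair_value f k) (dot gv (col k W)).
    by rewrite rmorph_prod; apply: eq_bigr => k _; exact: sqcharfE.
  rewrite prod_charf => /(congr1 (@complex.Re R)) /= ->.
  rewrite Re_sum; apply: eq_bigr => H _; rewrite Re_realM; congr (_ * cos _).
  rewrite dot_mulmx dotE; apply: eq_bigr => i _; rewrite !mxE; congr (_ * _).
  by rewrite dotE; apply: eq_bigr => k _; rewrite !mxE mulrC.
under eq_bigr do rewrite psiE mulr_sumr; rewrite exchange_big /=.
apply: ler_sum => H _; under eq_bigr do rewrite mulrCA.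
rewrite -mulr_sumr; apply: ler_wpM2l; first exact: weight_ge0.
by rewrite subr0; have [] := mean_cos_sign_vector N0 (WN H).
Qed.

(** The dominating function of [sqcharf_powR_le]. *)
Definition multiscale J L i y : R :=
  \sum_(j < L) 32 * 4^-1 ^+ j * psi i (2 ^+ J * 2^-1 ^+ j * y).

Lemma multiscale_gt0 J L i y : (J < L)%N -> 0 < psi i y -> 0 < multiscale J L i y.
Proof.
move=> JL psi0; rewrite /multiscale (bigD1 (Ordinal JL)) //= ltr_pwDl //.
  by rewrite -exprMn divff // expr1n mul1r !mulr_gt0 ?exprn_gt0.
by apply: sumr_ge0 => j _; rewrite !mulr_ge0 ?exprn_ge0 // sqcharf_ge0.
Qed.

Definition scaled_columns m (B : 'M[R]_(m, n)) d (f : 'I_d -> 'I_n) (a : 'I_d -> R) :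
  'M[R]_(m, d) := \matrix_(i, k) (a k * B i (f k)).

Lemma col_scaled_columns m (B : 'M[R]_(m, n)) d (f : 'I_d -> 'I_n) a k :
  col k (scaled_columns B f a) = a k *: col (f k) B.
Proof. by apply/matrixP => i j; rewrite !mxE. Qed.

(** Expanding the product chooses a scale [h k] at each position. Each choice is a case of
    [sum_sqcharf_le] with dilated columns, whose Gram determinant gains the squared product of the
    dilations. *)
Lemma sum_multiscale_le m N d (f : 'I_d -> 'I_n) (B : 'M[R]_(m, n)) (c : 'I_n -> R)
    (J : 'I_n -> nat) L : (0 < N)%N ->
  (forall k, 0 < c (f k)) ->
  (forall k, 4 ^+ J (f k) * c (f k) <= 1 /\ 1 < 4 ^+ (J (f k)).+1 * c (f k)) ->
  (forall (h : {ffun 'I_d -> 'I_L}) H k,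
    `|(scaled_columns B f (fun k => 2 ^+ J (f k) * 2^-1 ^+ h k) *m
       value (pair_value f) H) k 0| <= Num.sqrt N%:R) ->
  0 < gram_det B f ->
  \sum_(g : {ffun 'I_m * 'I_N -> bool}) sign_weight m N *
    \prod_k multiscale (J (f k)) L (f k) (dot (sign_vector R g) (col (f k) B))
  <= (128 ^+ 2 * q) ^+ d * expR (\sum_k dot (col (f k) B) (col (f k) B) / c (f k)) *
     Num.sqrt (\prod_k c (f k) / gram_det B f).
Proof.
move=> N0 c0 Jc WN D0.
set D := gram_det B f; set E := expR _.
pose a (h : {ffun 'I_d -> 'I_L}) k : R := 2 ^+ J (f k) * 2^-1 ^+ h k.
have a0 h k : 0 < a h k by rewrite mulr_gt0 ?exprn_gt0.
have sD : 0 < Num.sqrt D by rewrite sqrtr_gt0.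
pose C := (128 * q) ^+ d * E / Num.sqrt D.
(* [0 <= q] is deduced from an index, so [d = 0] is treated apart. *)
have qd0 : 0 <= (128 * q) ^+ d.
  have q0 (k : 'I_d) : 0 <= q := conc_ge0 (p0 (f k)) (conc (f k)).
  case: (d) q0 => [|d'] q0; first by rewrite expr0.
  by rewrite exprn_ge0 // mulr_ge0 // (q0 ord0).
have step (h : {ffun 'I_d -> 'I_L}) :
    \sum_(g : {ffun 'I_m * 'I_N -> bool}) sign_weight m N *
      \prod_k psi (f k) (a h k * dot (sign_vector R g) (col (f k) B)) <=
    C * \prod_k (a h k)^-1.
  have := sum_sqcharf_le N0 (WN h); set W := scaled_columns _ _ _.
  rewrite (@gram_det_scale _ _ _ _ B W d f id (a h)); last first.
    by move=> k; rewrite col_scaled_columns.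
  have pa0 : 0 < \prod_k a h k by rewrite prodr_gt0.
  rewrite sqrtrM ?sqr_ge0 // sqrtr_sqr gtr0_norm // -/D => hW.
  have e (g : {ffun 'I_m * 'I_N -> bool}) :
      \prod_k psi (f k) (a h k * dot (sign_vector R g) (col (f k) B)) =
      \prod_k psi (f k) (dot (sign_vector R g) (col k W)).
    by apply: eq_bigr => k _; rewrite col_scaled_columns dotZr.
  under [leLHS]eq_bigr do rewrite e.
  rewrite -/W -[leLHS](mulKf (lt0r_neq0 (mulr_gt0 pa0 sD))).
  apply: (@le_trans _ _ ((\prod_k a h k * Num.sqrt D)^-1 *
      ((128 * q) ^+ d * expR (\sum_k dot (col k W) (col k W))))).
    by rewrite ler_wpM2l // invr_ge0 mulr_ge0 // ltW.
  rewrite invfM -prodfV /C; set P := \prod_k _; set X := (128 * q) ^+ d.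
  have -> : P / Num.sqrt D * (X * expR (\sum_k dot (col k W) (col k W))) =
    X / Num.sqrt D * P * expR (\sum_k dot (col k W) (col k W)) by ring.
  have -> : X * E / Num.sqrt D * P = X / Num.sqrt D * P * E by ring.
  have P0 : 0 <= P by apply: prodr_ge0 => k _; apply: ltW; rewrite invr_gt0.
  rewrite ler_wpM2l //; first by rewrite !mulr_ge0 // invr_ge0 ltW.
  (* Squared dilations are at most [4 ^ J], hence at most [1 / c]. *)
  rewrite ler_expR; apply: ler_sum => k _.
  rewrite col_scaled_columns dotZl dotZr mulrA mulrC ler_wpM2l ?dot_ge0 //.
  rewrite -[leRHS]div1r ler_pdivlMr //; apply: le_trans (Jc k).1.
  rewrite ler_wpM2r ?(ltW (c0 k)) // /a mulrACA -!exprMn.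
  rewrite (_ : 2 * 2 = 4 :> R); last by ring.
  by rewrite ler_piMr ?exprn_ge0 // exprn_ile1 //; lra.
apply: (@le_trans _ _ (\sum_(h : {ffun 'I_d -> 'I_L})
    (\prod_k (32 * 4^-1 ^+ h k)) * (C * \prod_k (a h k)^-1))).
  rewrite (eq_bigr (fun g : {ffun 'I_m * 'I_N -> bool} =>
    \sum_(h : {ffun 'I_d -> 'I_L}) (\prod_k (32 * 4^-1 ^+ h k)) *
      (sign_weight m N *
      \prod_k psi (f k) (a h k * dot (sign_vector R g) (col (f k) B))))); last first.
    move=> g _; rewrite /multiscale bigA_distr_bigA /= mulr_sumr.
    by apply: eq_bigr => h _; rewrite big_split /= mulrCA.
  rewrite exchange_big /=; apply: ler_sum => h _.
  rewrite -mulr_sumr; apply: ler_wpM2l (step h).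
  by apply: prodr_ge0 => k _; rewrite mulr_ge0 ?exprn_ge0.
under [leLHS]eq_bigr do rewrite mulrCA -big_split /=.
rewrite -mulr_sumr -(bigA_distr_bigA (fun k (j : 'I_L) =>
  32 * 4^-1 ^+ j * (2 ^+ J (f k) * 2^-1 ^+ j)^-1)) /=.
(* Weight over dilation is [32 * 2 ^ - j / 2 ^ J], a geometric series in [j], and
   [2 ^ - J < 2 * Num.sqrt c]; the constant is [32 * 2 * 2]. *)
have scale k : \sum_(j < L) 32 * 4^-1 ^+ j * (2 ^+ J (f k) * 2^-1 ^+ j)^-1 <=
    128 * Num.sqrt (c (f k)).
  have J0 : 0 < 2 ^+ J (f k) :> R by rewrite exprn_gt0.
  have -> : \sum_(j < L) 32 * 4^-1 ^+ j * (2 ^+ J (f k) * 2^-1 ^+ j)^-1 =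
      32 / 2 ^+ J (f k) * \sum_(j < L) 2^-1 ^+ j :> R.
    rewrite mulr_sumr; apply: eq_bigr => j _.
    have -> : 4^-1 ^+ j = 2^-1 ^+ j * 2^-1 ^+ j :> R.
      by rewrite -exprMn; congr (_ ^+ _); field.
    have j0 : 0 < 2^-1 ^+ j :> R by rewrite exprn_gt0.
    by move: (2^-1 ^+ j) j0 => z z0; field; rewrite !gt_eqF.
  apply: (@le_trans _ _ (64 / 2 ^+ J (f k))).
    rewrite (_ : 64 / 2 ^+ J (f k) = 32 / 2 ^+ J (f k) * 2); last by ring.
    by rewrite ler_wpM2l ?sum_half_le // divr_ge0 // ltW.
  rewrite ler_pdivrMr //.
  suff : 1 <= 2 * Num.sqrt (c (f k)) * 2 ^+ J (f k) by lra.
  have -> : 2 * Num.sqrt (c (f k)) * 2 ^+ J (f k) = Num.sqrt (4 ^+ (J (f k)).+1 * c (f k)).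
    rewrite sqrtrM ?exprn_ge0 //.
    have -> : (4 : R) ^+ (J (f k)).+1 = (2 ^+ (J (f k)).+1) ^+ 2.
      by rewrite -exprM mulnC exprM; congr (_ ^+ _); ring.
    by rewrite sqrtr_sqr ger0_norm ?exprn_ge0 // exprS; ring.
  rewrite -{1}sqrtr1 ler_wsqrtr //; apply: ltW; exact: (Jc k).2.
apply: (@le_trans _ _ (C * \prod_k (128 * Num.sqrt (c (f k))))).
  apply: ler_wpM2l; first by rewrite divr_ge0 ?mulr_ge0 ?expR_ge0 // ltW.
  apply: ler_prod => k _; rewrite scale andbT.
  by apply: sumr_ge0 => j _; rewrite !mulr_ge0 ?invr_ge0 ?mulr_ge0 ?exprn_ge0.
rewrite big_split /= prodr_const card_ord -sqrtr_prod; last by move=> k; exact: ltW.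
rewrite sqrtrM; last by rewrite prodr_ge0 // => k _; exact: ltW.
rewrite sqrtrV ?(ltW D0) // /C.
have -> : (128 ^+ 2 * q) ^+ d = (128 * q) ^+ d * 128 ^+ d by rewrite -exprMn; congr (_ ^+ _); ring.
rewrite le_eqVlt; apply/orP; left; apply/eqP; ring.
Qed.

End FourierBounds.

(** * Hoelder's inequality over random tuples of columns *)

Section FourierCase.
Variables (R : realType) (S : finType) (n : nat).
Variables (p x : 'I_n -> S -> R) (q : R).
Hypothesis p0 : forall i s, 0 <= p i s.
Hypothesis p1 : forall i, \sum_s p i s = 1.
Hypothesis conc : forall i v, \sum_(s | `|x i s - v| <= 1) p i s <= q.
Hypothesis q0 : 0 < q.
Variables (m d : nat) (B : 'M[R]_(m, n)) (c : 'I_n -> R).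

Let E := gram_sum B d.
Let lam (f : {ffun 'I_d -> 'I_n}) : R := gram_det B f / E.

Hypothesis E0 : 0 < E.
Hypothesis c2 : forall i, c i <= 2^-1.
Hypothesis cE : forall i, \sum_f lam f * \sum_k (f k == i)%:R = c i.

Let b i : R := dot (col i B) (col i B).
Let cprod (f : {ffun 'I_d -> 'I_n}) : R := \prod_k c (f k).
Let bound (f : {ffun 'I_d -> 'I_n}) : R :=
  (128 ^+ 2 * q) ^+ d * expR (\sum_k b (f k) / c (f k)) *
  Num.sqrt (cprod f / gram_det B f).

Let lam_ge0 f : 0 <= lam f.
Proof. by rewrite divr_ge0 ?gram_det_ge0 ?ltW. Qed.

Let sum_lam : \sum_f lam f = 1.
Proof. by rewrite -mulr_suml divff ?gt_eqF. Qed.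

Let lam_gt0 f : lam f != 0 -> 0 < lam f.
Proof. by move=> h; rewrite lt_def h lam_ge0. Qed.

Let c_ge0 i : 0 <= c i.
Proof. by rewrite -cE; apply: sumr_ge0 => f _; rewrite mulr_ge0 // sumr_ge0. Qed.

(** Double counting: [c i] is the mean number of positions showing [i]. *)
Let sum_marginal (phi : 'I_n -> R) :
  \sum_f lam f * \sum_k phi (f k) = \sum_i c i * phi i.
Proof.
under [RHS]eq_bigr do rewrite -cE mulr_suml.
rewrite exchange_big /=; apply: eq_bigr => f _.
under [RHS]eq_bigr do rewrite -mulrA mulr_suml.
rewrite -mulr_sumr exchange_big /=; congr (_ * _); apply: eq_bigr => k _.
rewrite (bigD1 (f k)) //= eqxx mul1r big1 ?addr0 // => i.
by rewrite eq_sym => /negbTE ->; rewrite mul0r.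
Qed.

Let c_gt0 f k : lam f != 0 -> 0 < c (f k).
Proof.
move=> /lam_gt0 h; rewrite -cE (bigD1 f) //= ltr_pwDl //.
  rewrite mulr_gt0 // (bigD1 k) //= eqxx ltr_pwDl // sumr_ge0 //.
by apply: sumr_ge0 => g _; rewrite mulr_ge0 // sumr_ge0.
Qed.

Let gram_det_gt0 f : lam f != 0 -> 0 < gram_det B f.
Proof. by move/lam_gt0; rewrite pmulr_lgt0 // invr_gt0. Qed.

Let cprod_gt0 f : lam f != 0 -> 0 < cprod f.
Proof. by move=> h; apply: prodr_gt0 => k _; exact: c_gt0. Qed.

Let ratio_gt0 f : lam f != 0 -> 0 < cprod f / gram_det B f.
Proof. by move=> h; rewrite divr_gt0 ?cprod_gt0 ?gram_det_gt0. Qed.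

Let bound_gt0 f : lam f != 0 -> 0 < bound f.
Proof.
move=> h; rewrite !mulr_gt0 ?exprn_gt0 ?mulr_gt0 ?expR_gt0 //.
by rewrite sqrtr_gt0 ratio_gt0.
Qed.

(** The factor [lam f] is kept because [bound f] may be zero, and its logarithm a junk value, when
    [lam f = 0]. *)
Let ln_bound f : lam f * ln (bound f) = lam f * (d%:R * ln (128 ^+ 2 * q)) +
  lam f * (\sum_k b (f k) / c (f k)) + 2^-1 * (lam f * ln (cprod f / gram_det B f)).
Proof.
have [->|h] := eqVneq (lam f) 0; first by rewrite !(mul0r, mulr0, addr0).
have r0 := ratio_gt0 h.
have k0 : 0 < 128 ^+ 2 * q by rewrite mulr_gt0.
rewrite /bound lnM ?posrE ?mulr_gt0 ?exprn_gt0 ?expR_gt0 ?sqrtr_gt0 //.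
rewrite lnM ?posrE ?exprn_gt0 ?expR_gt0 // expRK lnXn // mulr_natl.
have : ln (Num.sqrt (cprod f / gram_det B f) ^+ 2) = ln (cprod f / gram_det B f).
  by rewrite sqr_sqrtr // ltW.
rewrite lnXn ?sqrtr_gt0 // -mulr_natl => <-.
by field.
Qed.

(* Jensen for ln; the c i sum to d, so their products over all tuples sum to d ^ d. *)
Let mean_ln_bound : expR (\sum_f lam f * ln (bound f)) * Num.sqrt E <=
  (128 ^+ 2 * q) ^+ d * Num.sqrt (d%:R ^+ d) * expR (hs2 B).
Proof.
under eq_bigr do rewrite ln_bound.
rewrite !big_split /= -mulr_suml sum_lam mul1r -mulr_sumr.
have k0 : 0 < 128 ^+ 2 * q by rewrite mulr_gt0.
rewrite !expRD expRM_natl lnK ?posrE // (sum_marginal (fun i => b i / c i)).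
have h1 : expR (\sum_i c i * (b i / c i)) <= expR (hs2 B).
  rewrite ler_expR; apply: ler_sum => i _.
  have [->|ci] := eqVneq (c i) 0; first by rewrite mul0r dot_ge0.
  by rewrite mulrC mulfVK.
have h2 : expR (\sum_f lam f * ln (cprod f / gram_det B f)) <= d%:R ^+ d / E.
  apply: le_trans (expR_jensen _ lam_ge0 sum_lam) _.
  have -> : d%:R = \sum_i c i.
    have := sum_marginal (fun=> 1); under [RHS]eq_bigr do rewrite mulr1.
    by move=> <-; rewrite -mulr_suml sum_lam mul1r sumr_const card_ord.
  have -> : (\sum_i c i) ^+ d = \sum_(f : {ffun 'I_d -> 'I_n}) cprod f.
    by rewrite -(bigA_distr_bigA (fun (_ : 'I_d) i => c i)) /= prodr_const card_ord.
  rewrite mulr_suml.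
  apply: ler_sum => f _; have [->|h] := eqVneq (lam f) 0.
    by rewrite mul0r divr_ge0 ?(ltW E0) // prodr_ge0.
  rewrite lnK ?posrE ?ratio_gt0 // /lam le_eqVlt; apply/orP; left; apply/eqP.
  by field; rewrite !gt_eqF ?gram_det_gt0.
have h3 : expR (2^-1 * \sum_f lam f * ln (cprod f / gram_det B f)) * Num.sqrt E <=
    Num.sqrt (d%:R ^+ d).
  rewrite -[leLHS]ger0_norm ?mulr_ge0 ?expR_ge0 ?sqrtr_ge0 //.
  rewrite -sqrtr_sqr ler_wsqrtr // exprMn sqr_sqrtr ?(ltW E0) //.
  by rewrite -expRM_natl mulrA divff // mul1r -ler_pdivlMr.
have := exprn_ge0 d (ltW k0); move: (_ ^+ d) => A A0.
rewrite -!mulrA ler_wpM2l //.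
by rewrite [leRHS]mulrC ler_pM ?mulr_ge0 ?expR_ge0 ?sqrtr_ge0.
Qed.

(** Hoelder by way of Jensen: each tuple product is divided by its own [bound f], so its mean over
    the signs is at most 1, and so is the mean of their [lam]-combination. The geometric mean [T] of
    the bounds is left as a factor. *)
Lemma gauss_mean_fourier u :
  gauss_mean p x 1 B u * Num.sqrt E <=
  (128 ^+ 2 * q) ^+ d * Num.sqrt (d%:R ^+ d) * expR (hs2 B).
Proof.
apply: le_trans mean_ln_bound; rewrite ler_wpM2r ?sqrtr_ge0 //.
set T := expR _.
have /choice[J hJ] : forall i, exists J, 0 < c i -> 4 ^+ J * c i <= 1 /\ 1 < 4 ^+ J.+1 * c i.
  move=> i; have [ci|_] := ltP 0 (c i); last by exists 0%N.
  have c1 : c i <= 1 by apply: le_trans (c2 i) _; lra.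
  have [J hJ] := pow4_bracket ci c1.
  by exists J.
(* The number of scales, and below the number of signs, must be common to all columns and tuples. *)
pose L := (\sum_i J i).+1.
have JL i : (J i < L)%N by rewrite ltnS (bigD1 i) //= leq_addr.
pose W (f : {ffun 'I_d -> 'I_n}) (h : {ffun 'I_d -> 'I_L}) :=
  scaled_columns B f (fun k => 2 ^+ J (f k) * 2^-1 ^+ h k).
have [N1 hN1] := sqrt_nat_bound (fun Fk : {ffun 'I_n -> S} * 'I_m =>
  (B *m value x Fk.1 - u) Fk.2 0).
have [N2 hN2] := sqrt_nat_bound (fun z : {ffun 'I_d -> 'I_n} * {ffun 'I_d -> 'I_L} *
    {ffun 'I_d -> S * S} * 'I_m =>
  (W z.1.1.1 z.1.1.2 *m value (pair_value x z.1.1.1) z.1.2) z.2 0).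
pose N := (N1 + N2).+1.
have N1N : (N1 <= N)%N by rewrite leqW // leq_addr.
have N2N : (N2 <= N)%N by rewrite leqW // leq_addl.
have N0 : (0 < N)%N by [].
apply: le_trans (gauss_mean_le_charf p0 N0 (fun F k => hN1 N N1N (F, k))) _.
pose y (g : {ffun 'I_m * 'I_N -> bool}) i := dot (sign_vector R g) (col i B).
pose psi i := sqcharf (p i) (x i).
pose F i := multiscale p x (J i) L i.
have F0 i z : 0 <= F i z.
  by apply: sumr_ge0 => j _; rewrite !mulr_ge0 ?exprn_ge0 ?sqcharf_ge0.
have pointwise g : \prod_i Num.sqrt (psi i (y g i)) <=
    T * \sum_f lam f * (\prod_k F (f k) (y g (f k)) / bound f).
  have rhs0 : 0 <= T * \sum_f lam f * (\prod_k F (f k) (y g (f k)) / bound f).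
    rewrite mulr_ge0 ?expR_ge0 // sumr_ge0 // => f _.
    have [->|h] := eqVneq (lam f) 0; first by rewrite mul0r.
    by rewrite mulr_ge0 // divr_ge0 ?prodr_ge0 // ltW ?bound_gt0.
  (* A vanishing factor makes the left side zero; otherwise all logarithms below are genuine. *)
  have [[i psi0]|psi0] := pselect (exists i, psi i (y g i) = 0).
    by rewrite (bigD1 i) //= psi0 sqrtr0 mul0r.
  have {}psi0 i : 0 < psi i (y g i).
    rewrite lt_def sqcharf_ge0 andbT; apply/negP => /eqP h; apply: psi0; by exists i.
  have Fp i : 0 < F i (y g i) by exact: multiscale_gt0 (JL i) (psi0 i).
  apply: (@le_trans _ _ (expR (\sum_i c i * ln (F i (y g i))))).
    rewrite expR_sum; apply: ler_prod => i _; rewrite sqrtr_ge0 /=.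
    have [->|ci] := eqVneq (c i) 0.
      by rewrite mul0r expR0 -sqrtr1 ler_wsqrtr // sqcharf_le1.
    have ci0 : 0 < c i by rewrite lt_def ci c_ge0.
    have h := sqcharf_powR_le (p0 i) (p1 i) ci0 (c2 i) (hJ i ci0).1 (JL i) (psi0 i).
    exact h.
  rewrite -(sum_marginal (fun i => ln (F i (y g i)))).
  have -> : \sum_f lam f * \sum_k ln (F (f k) (y g (f k))) =
      \sum_f lam f * ln (bound f) +
      \sum_f lam f * (\sum_k ln (F (f k) (y g (f k))) - ln (bound f)).
    by rewrite -big_split /=; apply: eq_bigr => f _; rewrite mulrBr addrC subrK.
  rewrite expRD ler_wpM2l ?expR_ge0 //.
  apply: le_trans (expR_jensen _ lam_ge0 sum_lam) _; apply: ler_sum => f _.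
  have [->|h] := eqVneq (lam f) 0; first by rewrite !mul0r.
  rewrite ler_wpM2l // expRD expRN lnK ?posrE ?bound_gt0 // expR_sum.
  by under eq_bigr do rewrite lnK ?posrE //.
apply: (@le_trans _ _ (\sum_(g : {ffun 'I_m * 'I_N -> bool}) sign_weight R m N *
    (T * \sum_f lam f * (\prod_k F (f k) (y g (f k)) / bound f)))).
  by apply: ler_sum => g _; rewrite ler_wpM2l ?sign_weight_ge0 // pointwise.
under eq_bigr do rewrite mulrCA; rewrite -mulr_sumr -[leRHS]mulr1 ler_wpM2l ?expR_ge0 //.
under eq_bigr do rewrite mulr_sumr; rewrite exchange_big /=.
apply: (@le_trans _ _ (\sum_f lam f)); last by rewrite sum_lam.
apply: ler_sum => f _; have [->|h] := eqVneq (lam f) 0.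
  by rewrite big1 // => g _; rewrite mul0r mulr0.
have -> : \sum_(g : {ffun 'I_m * 'I_N -> bool})
      sign_weight R m N * (lam f * (\prod_k F (f k) (y g (f k)) / bound f)) =
    lam f * ((\sum_(g : {ffun 'I_m * 'I_N -> bool})
      sign_weight R m N * \prod_k F (f k) (y g (f k))) / bound f).
  rewrite mulr_suml mulr_sumr; apply: eq_bigr => g _; rewrite mulrCA !mulrA //.
rewrite ler_piMr // ler_pdivrMr ?bound_gt0 // mul1r.
apply: sum_multiscale_le => //.
- by move=> k; exact: c_gt0.
- by move=> k; apply: hJ; exact: c_gt0.
- by move=> h' H k; exact: (hN2 N N2N (f, h', H, k)).
- exact: gram_det_gt0.
Qed.

End FourierCase.

(** * Small ball probabilities for finite laws *)

Section FiniteSmallBall.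
Variables (R : realType) (S : finType) (n : nat).
Variables (p x : 'I_n -> S -> R) (q : R).
Hypothesis p0 : forall i s, 0 <= p i s.
Hypothesis p1 : forall i, \sum_s p i s = 1.
Hypothesis conc : forall i v, \sum_(s | `|x i s - v| <= 1) p i s <= q.
Hypothesis q0 : 0 < q.

(* Some column i carrying more than half of its possible share of the total Gram
   determinant is removed by averaging over [X_i]; otherwise all characteristic
   functions enter with exponent at least 2. *)
Lemma gauss_mean_gram_sum m d (B : 'M[R]_(m, n)) u :
  gauss_mean p x 1 B u * Num.sqrt (gram_sum B d) <=
  (128 ^+ 2 * q) ^+ d * Num.sqrt (d%:R ^+ d) * expR (hs2 B).
Proof.
have k0 : 0 < 128 ^+ 2 * q by rewrite mulr_gt0.
elim: d B u => [|d IH] B u.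
  rewrite gram_sum0 !expr0 sqrtr1 !mul1r mulr1.
  apply: (@le_trans _ _ 1); first exact: gauss_mean_le1.
  by rewrite -[leLHS]expR0 ler_expR hs2_ge0.
have [E0|E0] := leP (gram_sum B d.+1) 0.
  by rewrite (ler0_sqrtr E0) mulr0 !mulr_ge0 ?exprn_ge0 ?sqrtr_ge0 ?expR_ge0 ?(ltW k0).
set E := gram_sum B d.+1 in E0 *.
pose E' i := gram_sum (reject (col i B) *m B) d.
(* By [gram_sum_marg] the [d.+1] positions have equal chances of showing [i]; [c i] is their sum. *)
pose c i := d.+1%:R * (dot (col i B) (col i B) * E' i) / E.
have [[i ci]|small] := pselect (exists i, 2^-1 < c i); last first.
  apply: (gauss_mean_fourier p0 p1 conc q0 (c := c)) => // i.
    by rewrite leNgt; apply/negP => h; apply: small; exists i.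
  transitivity (\sum_k \sum_(f : {ffun 'I_d.+1 -> 'I_n} | f k == i) gram_det B f / E).
    under eq_bigr do rewrite mulr_sumr; rewrite exchange_big /=.
    apply: eq_bigr => k _; rewrite [RHS]big_mkcond /=; apply: eq_bigr => f _.
    by case: eqP; rewrite ?mulr1 ?mulr0.
  under eq_bigr do rewrite -mulr_suml gram_sum_marg.
  by rewrite sumr_const card_ord -mulr_natl mulrA.
set b := col i B; set B' := reject b *m B.
have bE' : Num.sqrt E <= Num.sqrt (2 * d.+1%:R) * (Num.sqrt (dot b b) * Num.sqrt (E' i)).
  rewrite -!sqrtrM ?dot_ge0 ?mulr_ge0 // ler_wsqrtr //.
  move: ci; rewrite /c ltr_pdivlMr // -/b => /ltW; lra.
have G0 : 0 <= gauss_mean p x 1 B u by apply: gauss_mean_ge0.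
apply: le_trans (ler_wpM2l G0 bE') _.
have le41 : 4^-1 <= 1 :> R by lra.
have rem := gauss_mean_reject p0 p1 conc u le41 (erefl (col i B)).
rewrite -/b -/B' in rem.
have IH' := IH B' (reject b *m u).
apply: (@le_trans _ _ (Num.sqrt (2 * d.+1%:R) * (128 * q * expR (dot b b) *
    ((128 ^+ 2 * q) ^+ d * Num.sqrt (d%:R ^+ d) * expR (hs2 B'))))).
  rewrite mulrCA ler_wpM2l ?sqrtr_ge0 // mulrCA [leLHS]mulrA.
  apply: le_trans (ler_wpM2r (sqrtr_ge0 _) rem) _.
  by rewrite -[leLHS]mulrA ler_wpM2l // !mulr_ge0 ?expR_ge0 // ltW.
have eh : expR (dot b b) * expR (hs2 B') <= expR (hs2 B).
  by rewrite -expRD ler_expR -lerBrDl hs2_reject.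
(* The loss [2 * d.+1] is absorbed by going from [d ^ d] to [d.+1 ^ d.+1] and by the second factor
   [128]. *)
have sd : Num.sqrt (2 * d.+1%:R) * Num.sqrt (d%:R ^+ d) <= 128 * Num.sqrt (d.+1%:R ^+ d.+1) :> R.
  have -> : 128 * Num.sqrt (d.+1%:R ^+ d.+1) = Num.sqrt (128 ^+ 2 * d.+1%:R ^+ d.+1 : R).
    by rewrite sqrtrM ?sqr_ge0 // sqrtr_sqr ger0_norm.
  rewrite -sqrtrM ?mulr_ge0 // ler_wsqrtr // (exprS d.+1%:R) mulrA.
  rewrite ler_pM ?mulr_ge0 ?exprn_ge0 //.
    by rewrite ler_wpM2r //; lra.
  by rewrite lerXn2r ?nnegrE // ler_nat.
rewrite (exprS (128 ^+ 2 * q)); set X := (_ ^+ d).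
have X0 : 0 <= X by rewrite exprn_ge0 // ltW.
have -> : Num.sqrt (2 * d.+1%:R) * (128 * q * expR (dot b b) *
    (X * Num.sqrt (d%:R ^+ d) * expR (hs2 B'))) =
  128 * q * X * ((Num.sqrt (2 * d.+1%:R) * Num.sqrt (d%:R ^+ d)) *
    (expR (dot b b) * expR (hs2 B'))) by ring.
have -> : 128 ^+ 2 * q * X * Num.sqrt (d.+1%:R ^+ d.+1) * expR (hs2 B) =
  128 * q * X * ((128 * Num.sqrt (d.+1%:R ^+ d.+1)) * expR (hs2 B)) by ring.
rewrite ler_wpM2l ?mulr_ge0 ?(ltW q0) //.
by rewrite ler_pM ?mulr_ge0 ?sqrtr_ge0 ?expR_ge0.
Qed.

(** Markov's inequality for the Gaussian of [a *: A], with [a] such that the ball has squared radius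
    [4 * d]: this costs [expR 4] per dimension, and [hs2 (a *: A) <= d] costs another [expR 1]. The
    lower bound on the Gram sum contains [d ^ d], which cancels [Num.sqrt (d ^ d)]. *)
Lemma finite_small_ball m (A : 'M[R]_(m, n)) u d (M eps tau : R) :
  0 < hs2 A -> 1 <= M -> 0 < eps -> (0 < d)%N -> 0 <= tau ->
  (forall y, dot (A^T *m y) (A^T *m y) <= tau * dot y y) ->
  (forall k, (k < d)%N -> eps * hs2 A <= hs2 A - k%:R * tau) ->
  \sum_(F | dot (A *m value x F - u) (A *m value x F - u) <= 4 * (M ^+ 2 * hs2 A))
    weight p F <= (128 ^+ 2 * expR 5 / Num.sqrt eps * M * q) ^+ d.
Proof.
move=> h0 M1 e0 d0 tau0 tauA hk; set h := hs2 A in h0 hk *.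
have M0 : 0 < M by apply: lt_le_trans M1.
have dR : 0 < d%:R :> R by rewrite ltr0n.
pose a := Num.sqrt (d%:R / (M ^+ 2 * h)).
have a2 : a ^+ 2 = d%:R / (M ^+ 2 * h).
  by rewrite sqr_sqrtr // ltW // divr_gt0 // mulr_gt0 ?exprn_gt0.
have a0 : 0 < a by rewrite sqrtr_gt0 divr_gt0 // mulr_gt0 ?exprn_gt0.
have G := @gauss_mean_gram_sum m d (a *: A) (a *: u).
have hsE : hs2 (a *: A) <= d%:R.
  have -> : hs2 (a *: A) = a ^+ 2 * h.
    rewrite /h /hs2 mulr_sumr; apply: eq_bigr => i _.
    have -> : col i (a *: A) = a *: col i A by apply/matrixP => k j; rewrite !mxE.
    by rewrite dotZl dotZr mulrA.
  rewrite a2 invfM mulrA mulfVK ?gt_eqF // ler_pdivrMr ?exprn_gt0 //.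
  by rewrite ler_peMr ?(ltW dR) // expr_ge1 // ltW.
have gs : (d%:R * eps / M ^+ 2) ^+ d <= gram_sum (a *: A) d.
  rewrite gram_sumZ exprAC a2.
  have -> : d%:R * eps / M ^+ 2 = d%:R / (M ^+ 2 * h) * (eps * h).
    by field; rewrite !gt_eqF.
  rewrite exprMn ler_wpM2l ?exprn_ge0 //.
    by rewrite divr_ge0 // ltW // mulr_gt0 ?exprn_gt0.
  by apply: gram_sum_ge tauA hk => //; rewrite mulr_ge0 // ltW.
apply: (@le_trans _ _ (expR 4 ^+ d * gauss_mean p x 1 (a *: A) (a *: u))).
  rewrite /gauss_mean mulr_sumr [leLHS]big_mkcond /=; apply: ler_sum => F _.
  have w0 : 0 <= weight p F := weight_ge0 p0 F.
  case: ifP => hF; last by rewrite !mulr_ge0 ?exprn_ge0 ?expR_ge0.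
  rewrite mulrCA -[leLHS]mulr1 ler_wpM2l // -expRM_natl -expRD -[leLHS]expR0 ler_expR.
  rewrite -scalemxAl -scalerBr dotZl dotZr mul1r mulrA -expr2 a2.
  rewrite subr_ge0 mulrAC ler_pdivrMr ?mulr_gt0 ?exprn_gt0 // -mulrA ler_wpM2l //.
have sX : 0 < Num.sqrt ((d%:R * eps / M ^+ 2) ^+ d).
  by rewrite sqrtr_gt0 exprn_gt0 // divr_gt0 ?exprn_gt0 ?mulr_gt0.
rewrite -(ler_pM2r sX).
apply: (@le_trans _ _ (expR 4 ^+ d * ((128 ^+ 2 * q) ^+ d * Num.sqrt (d%:R ^+ d) * expR d%:R))).
  rewrite -[leLHS]mulrA; apply: ler_wpM2l; first by rewrite exprn_ge0 ?expR_ge0.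
  apply: (@le_trans _ _ (gauss_mean p x 1 (a *: A) (a *: u) *
      Num.sqrt (gram_sum (a *: A) d))).
    by rewrite ler_wpM2l ?gauss_mean_ge0 // ler_wsqrtr.
  apply: (le_trans G); rewrite ler_wpM2l ?ler_expR // mulr_ge0 ?sqrtr_ge0 //.
  by rewrite exprn_ge0 ?mulr_ge0 // ltW.
have sqX (y : R) : 0 <= y -> Num.sqrt (y ^+ d) = Num.sqrt y ^+ d.
  move=> y0; have -> : y ^+ d = (Num.sqrt y ^+ d) ^+ 2 by rewrite exprAC sqr_sqrtr.
  by rewrite sqrtr_sqr ger0_norm // exprn_ge0 ?sqrtr_ge0.
have e0' : 0 < Num.sqrt eps by rewrite sqrtr_gt0.
rewrite !sqX ?(ltW dR) //; last by rewrite divr_ge0 ?mulr_ge0 ?exprn_ge0 // ltW.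
have -> : expR d%:R = expR 1 ^+ d :> R by rewrite -expRM_natl mulr1.
rewrite -!exprMn le_eqVlt; apply/orP; left; apply/eqP; congr (_ ^+ _).
rewrite !sqrtrM ?mulr_ge0 ?(ltW dR) ?(ltW e0) // sqrtrV ?sqr_ge0 // sqrtr_sqr gtr0_norm //.
have -> : expR 5 = expR 4 * expR 1 :> R by rewrite -expRD; congr expR; ring.
by field; rewrite !gt_eqF.
Qed.

End FiniteSmallBall.

(** * Probabilities as real numbers *)

Section RealProbability.
Variables (d : measure_display) (T : measurableType d) (R : realType).
Variable P : probability T R.

Lemma EFin_fine_prob (A : set T) : measurable A -> (fine (P A))%:E = P A.
Proof. by move=> mA; rewrite fineK // fin_num_measure. Qed.

Lemma fine_prob_ge0 (A : set T) : 0 <= fine (P A).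
Proof. exact: fine_ge0 (measure_ge0 P A). Qed.

Lemma fine_prob_le (A B : set T) : measurable A -> measurable B -> A `<=` B ->
  fine (P A) <= fine (P B).
Proof.
move=> mA mB AB; rewrite -lee_fin !EFin_fine_prob //.
by apply: le_measure => //; exact: mem_set.
Qed.

Lemma fine_prob_bigcup_le (I : choiceType) (r : seq I) (A : I -> set T) :
  (forall i, measurable (A i)) ->
  fine (P (\bigcup_(i in [set` r]) A i)) <= \sum_(i <- r) fine (P (A i)).
Proof.
move=> mA; rewrite bigcup_seq; elim: r => [|i r IH].
  by rewrite !big_nil measure0.
have mr : measurable (\big[setU/set0]_(j <- r) A j) by apply: bigsetU_measurable.
rewrite !big_cons; apply: le_trans (lerD (lexx _) IH).
rewrite -lee_fin EFinD !EFin_fine_prob //; first exact: measureU2.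
exact: measurableU.
Qed.

Lemma fine_prob_bigcup (I : choiceType) (r : seq I) (A : I -> set T) :
  (forall i, measurable (A i)) -> (forall i j w, A i w -> A j w -> i = j) -> uniq r ->
  fine (P (\bigcup_(i in [set` r]) A i)) = \sum_(i <- r) fine (P (A i)).
Proof.
move=> mA disj; elim: r => [|i r IH] /=.
  by rewrite bigcup_seq !big_nil measure0.
move=> /andP[ir ur]; rewrite big_cons -IH // !bigcup_seq big_cons.
have mr : measurable (\big[setU/set0]_(j <- r) A j) by apply: bigsetU_measurable.
apply: EFin_inj; rewrite EFinD !EFin_fine_prob //; last exact: measurableU.
apply: measureU => //; apply/seteqP; split => // w [Ai].
rewrite -bigcup_seq => -[j jr Aj]; have e := disj _ _ _ Ai Aj.
by move: ir; rewrite e (_ : j \in r).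
Qed.

End RealProbability.

(** * Tails and short intervals of a real random variable *)

Section OneRandomVariable.
Variables (d : measure_display) (T : measurableType d) (R : realType).
Variables (P : probability T R) (X : {RV P >-> R}).

Let mX (B : set R) : measurable B -> measurable (X @^-1` B).
Proof.
by move=> mB; rewrite -[X in measurable X]setTI; exact: measurable_funPT.
Qed.

Lemma measurable_dist_le (v t : R) : measurable [set w | `|X w - v| <= t].
Proof.
rewrite (_ : [set w | _] = X @^-1` `[v - t, v + t]); first exact: mX.
by apply/seteqP; split => w /=; rewrite in_itv /= ler_norml => /andP[h1 h2];
  apply/andP; split; lra.
Qed.

(** Continuity from above at the empty set. All larger [l] are included so that one window can serve
    every coordinate; it is half-open to be tiled by cells. *)
Lemma tightness (eta : R) : 0 < eta -> exists2 K : R, 0 < K &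
  forall l, K <= l -> fine (P [set w | ~ (- l <= X w < l)]) <= eta.
Proof.
move=> eta0.
pose F (k : nat) := X @^-1` (~` `[- k.+1%:R, k.+1%:R[).
have mF k : measurable (F k) by apply: mX; exact: measurableC.
have F0 : \bigcap_k F k = set0.
  apply/seteqP; split => // w h.
  have := h (Num.truncn `|X w|) I; rewrite /F /= in_itv /=; apply.
  have /andP[_ k1] := truncn_itv (normr_ge0 (X w)).
  have := ler_norm (X w); have := ler_norm (- X w); rewrite normrN => h1 h2.
  by apply/andP; split; lra.
have cv : (P \o F) k @[k --> \oo] --> (0 : \bar R)%E.
  rewrite -(measure0 P) -F0; apply: nonincreasing_cvg_mu => //.
  - by rewrite ltey_eq fin_num_measure.
  - by rewrite F0; exact: measurable0.
  - move=> k k' kk'; rewrite subsetEset => w; rewrite /F /= !in_itv /=; apply: contra_not.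
    have : (k.+1%:R : R) <= k'.+1%:R by rewrite ler_nat ltnS.
    by move=> h /andP[h1 h2]; apply/andP; split; lra.
have [k _ hk] : \forall k \near \oo, (P (F k) < eta%:E)%E.
  have /fine_cvgP[_ cv'] := cv.
  have h := cvgr_lt _ cv' _ eta0; near=> k.
  rewrite -EFin_fine_prob // lte_fin; near: k; exact: h.
exists k.+1%:R => // l kl.
have := ltW (hk k (leqnn k)); rewrite -EFin_fine_prob // lee_fin; apply: le_trans.
apply: fine_prob_le => //.
  rewrite (_ : [set w | _] = X @^-1` (~` `[- l, l[)); first by apply: mX; exact: measurableC.
  by apply/seteqP; split => w /=; rewrite in_itv.
move=> w /=; rewrite /F /= in_itv /=; apply: contra_not.
by move=> /andP[h1 h2]; apply/andP; split; lra.
Unshelve. all: by end_near. Qed.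

(* Compactness upgrades the bound on atoms to a bound on all short intervals. *)
Lemma conc_right_continuous0 (p eta : R) : 0 < eta ->
  (forall v, fine (P [set w | `|X w - v| <= 0]) <= p) ->
  exists2 t : R, 0 < t & forall v, fine (P [set w | `|X w - v| <= t]) <= p + eta.
Proof.
move=> eta0 atoms.
have p0 : 0 <= p by apply: le_trans (fine_prob_ge0 _ _) (atoms 0).
have [K K0 hK] := tightness eta0.
have near0 v : exists2 r : R, 0 < r & fine (P [set w | `|X w - v| <= r]) <= p + eta.
  pose F (k : nat) := [set w | `|X w - v| <= k.+1%:R^-1].
  have mF k : measurable (F k) by exact: measurable_dist_le.
  have FE : \bigcap_k F k = [set w | `|X w - v| <= 0].
    apply/seteqP; split => w /= h; last first.
      by move=> k _; apply: le_trans h _; rewrite invr_ge0.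
    apply/ler_addgt0Pr => e e0; rewrite add0r.
    have := h (Num.truncn e^-1) I; rewrite /F /= => h'; apply: le_trans h' _.
    have e'0 : 0 <= e^-1 by rewrite invr_ge0 ltW.
    have /andP[_ /ltW k1] := truncn_itv e'0.
    by rewrite -[leRHS]invrK lef_pV2 ?posrE ?invr_gt0.
  have cv : (P \o F) k @[k --> \oo] --> P [set w | `|X w - v| <= 0].
    rewrite -FE; apply: nonincreasing_cvg_mu => //.
    - by rewrite ltey_eq fin_num_measure.
    - by rewrite FE; exact: measurable_dist_le.
    - move=> k k' kk'; rewrite subsetEset => w; rewrite /F /= => h; apply: le_trans h _.
      by rewrite lef_pV2 ?posrE // ler_nat ltnS.
  have [k _ hk] : \forall k \near \oo, fine (P (F k)) <= p + eta.
    rewrite -(EFin_fine_prob _ (measurable_dist_le _ _)) in cv.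
    have /fine_cvgP[_ cv'] := cv.
    apply: (cvgr_le _ cv'); apply: le_lt_trans (atoms v) _; by rewrite ltrDl.
  by exists k.+1%:R^-1; [rewrite invr_gt0|exact: hk (leqnn k)].
have cpt := @segment_compact R (- (K + 1)) (K + 1).
pose Q t v := fine (P [set w | `|X w - v| <= t]) <= p + eta.
have : \forall t \near (0 : R)^'+, `[- (K + 1), K + 1] `<=` Q t.
  apply: ((compact_near_coveringP _).1 cpt) => v _.
  have [r r0 hr] := near0 v.
  have r2 : 0 < r / 2 by rewrite divr_gt0.
  (* Half of [r] is spent on moving the centre, half on the radius. *)
  exists (ball v (r / 2), [set t : R | t <= r / 2]) => /=.
    by split; [exact: nbhsx_ballx|exact: nbhs_right_le].
  move=> [v' t] /= [vv' tr]; rewrite /Q; apply: le_trans hr.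
  apply: fine_prob_le => [||w /= h]; try exact: measurable_dist_le.
  have -> : X w - v = (X w - v') + (v' - v) by ring.
  apply: le_trans (ler_normD _ _) _; rewrite [r]splitr; apply: lerD.
    exact: le_trans h tr.
  by rewrite distrC ltW.
move=> hQ; near (0 : R)^'+ => t.
exists t => // v.
have t1 : t <= 1 by near: t; exact: nbhs_right_le.
(* For [v] beyond the margin [K + 1], [t <= 1] puts the whole interval outside [[-K, K[], where the
   mass is at most [eta]. *)
have [vK|vK] := boolP (v \in `[- (K + 1), K + 1]); first by apply: (near hQ t).
apply: (@le_trans _ _ eta); last by rewrite lerDr.
apply: le_trans (hK K (lexx K)); apply: fine_prob_le => [||w /= h].
- exact: measurable_dist_le.
- rewrite (_ : [set w | _] = X @^-1` (~` `[- K, K[)); first by apply: mX; exact: measurableC.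
  by apply/seteqP; split => w /=; rewrite in_itv.
- move=> /andP[h1 h2]; move: vK; rewrite in_itv /=; apply/negP; rewrite negbK.
  by move: h; rewrite ler_norml => /andP[h3 h4]; apply/andP; split; lra.
Unshelve. all: by end_near. Qed.

End OneRandomVariable.

(** * Reduction to finitely supported variables *)

Section Norms.
Variable R : realType.

Lemma l2normE k (v : 'cV[R]_k) : l2norm v = Num.sqrt (dot v v).
Proof. by rewrite /l2norm dotE; congr Num.sqrt; apply: eq_bigr. Qed.

Lemma hs_normE m n (A : 'M[R]_(m, n)) : hs_norm A = Num.sqrt (hs2 A).
Proof.
rewrite /hs_norm /hs2 exchange_big /=; congr Num.sqrt; apply: eq_bigr => j _.
by rewrite dotE; apply: eq_bigr => i _; rewrite mxE expr2.
Qed.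

Lemma hs2_trmx m n (A : 'M[R]_(m, n)) : hs2 A^T = hs2 A.
Proof.
rewrite /hs2; under eq_bigr do rewrite dotE; rewrite exchange_big /=.
apply: eq_bigr => j _; rewrite dotE; apply: eq_bigr => i _; by rewrite !mxE.
Qed.

Lemma dot_mulmx_le_hs2 m n (A : 'M[R]_(m, n)) x :
  dot (A *m x) (A *m x) <= hs2 A * dot x x.
Proof.
rewrite -{1 2}(trmxK A) dot_trmx -(hs2_trmx A) mulr_suml; apply: ler_sum => i _.
by rewrite mulrC dot_sqr_le.
Qed.

Lemma dot_mulmx_le_op m n (A : 'M[R]_(m, n)) x :
  dot (A *m x) (A *m x) <= op_norm A ^+ 2 * dot x x.
Proof.
have [/eqP|x0] := eqVneq (dot x x) 0.
  by rewrite dot_eq0 => /eqP ->; rewrite mulmx0 dotE [dot _ _]dotE !big1 ?mulr0 // => i _;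
    rewrite mxE mul0r.
have xp : 0 < dot x x by rewrite lt_def x0 dot_ge0.
pose y := (Num.sqrt (dot x x))^-1 *: x.
have sx : 0 < Num.sqrt (dot x x) by rewrite sqrtr_gt0.
have y1 : dot y y = 1.
  by rewrite dotZl dotZr mulrA -expr2 exprVn sqr_sqrtr ?dot_ge0 // mulVf.
have xE : x = Num.sqrt (dot x x) *: y by rewrite scalerA divff ?gt_eqF // scale1r.
have opy : l2norm (A *m y) <= op_norm A.
  apply: ub_le_sup; last by exists y => //=; rewrite l2normE y1 sqrtr1.
  (* The real supremum is an upper bound only for a bounded set; the Hilbert-Schmidt norm bounds
     it. *)
  exists (Num.sqrt (hs2 A)) => _ [z /= z1 <-]; rewrite l2normE ler_wsqrtr //.
  apply: le_trans (dot_mulmx_le_hs2 A z) _; rewrite ler_piMr ?hs2_ge0 //.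
  by move: z1; rewrite l2normE -{1}sqrtr1 ler_sqrt.
rewrite {1 2}xE -scalemxAr dotZl dotZr mulrA -expr2 sqr_sqrtr ?dot_ge0 // mulrC.
rewrite ler_wpM2r ?dot_ge0 // -[leLHS]sqr_sqrtr ?dot_ge0 // -l2normE.
have l0 : 0 <= l2norm (A *m y) by rewrite l2normE sqrtr_ge0.
by rewrite lerXn2r ?nnegrE // (le_trans l0).
Qed.

(** With [z = A^T y], Cauchy-Schwarz gives [|z|^4 = <y, A z>^2 <= |y|^2 * |A z|^2]; then [|z|^2] is
    cancelled. *)
Lemma dot_trmx_le_op m n (A : 'M[R]_(m, n)) y :
  dot (A^T *m y) (A^T *m y) <= op_norm A ^+ 2 * dot y y.
Proof.
set z := A^T *m y; have [->|z0] := eqVneq (dot z z) 0.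
  by rewrite mulr_ge0 ?sqr_ge0 ?dot_ge0.
have zp : 0 < dot z z by rewrite lt_def z0 dot_ge0.
have e : dot z z = dot y (A *m z) by rewrite (dot_mulmx A y z).
rewrite -(ler_pM2l zp) -[leLHS]expr2 {1}e; apply: le_trans (dot_sqr_le _ _) _.
rewrite [leRHS]mulrA [leRHS]mulrC ler_wpM2l ?dot_ge0 // [leRHS]mulrC.
exact: dot_mulmx_le_op.
Qed.

Lemma dotD_le m (a b : 'cV[R]_m) : dot (a + b) (a + b) <= 2 * dot a a + 2 * dot b b.
Proof.
have := dot_ge0 (a - b); rewrite !(dotBl, dotBr, dotDl, dotDr) (dotC b a).
lra.
Qed.

End Norms.

(** * Rounding independent variables to finite laws *)

Section Discretization.
Variables (d : measure_display) (T : measurableType d) (R : realType).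
Variables (P : probability T R) (n : nat) (X : 'I_n -> {RV P >-> R}).
Hypothesis indep : mutually_independent X.

Let mX i (B : set R) : measurable B -> measurable (X i @^-1` B).
Proof.
by move=> mB; rewrite -[X in measurable X]setTI; exact: measurable_funPT.
Qed.

Lemma fine_prob_box (B : 'I_n -> set R) : (forall i, measurable (B i)) ->
  fine (P (\bigcap_(i in [set` [set: 'I_n]%SET]) (X i @^-1` B i))) =
  \prod_i fine (P (X i @^-1` B i)).
Proof.
move=> mB; rewrite indep //; apply: EFin_inj.
rewrite (big_morph EFin (@EFinM R) erefl) fineK.
  by apply: eq_big => i; rewrite ?inE // => _; rewrite EFin_fine_prob //; exact: mX.
rewrite (eq_bigr (fun i => (fine (P (X i @^-1` B i)))%:E)).
  by rewrite -(big_morph EFin (@EFinM R) erefl).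
by move=> i _; rewrite EFin_fine_prob //; exact: mX.
Qed.

(** Values in a large window are rounded down to a grid of step [dl]; the rest goes to the label
    [None], of mass at most [eta]. The last clause carries an event over to rounded configurations,
    at the price of one tail per coordinate. *)
Lemma discretization (t dl eta q : R) : 0 < dl -> dl <= t -> 0 < eta ->
  (forall i v, fine (P [set w | `|X i w - v| <= t]) <= q) ->
  exists (S : finType) (p : 'I_n -> S -> R) (x : S -> R),
  [/\ forall i s, 0 <= p i s,
      forall i, \sum_s p i s = 1,
      forall i v, \sum_(s | `|x s - v| <= t) p i s <= 2 * q + eta &
      forall (G : set T) (g : pred {ffun 'I_n -> S}), measurable G ->
        (forall w (F : {ffun 'I_n -> S}), (forall i, `|X i w - x (F i)| <= dl) -> G w -> g F) ->
        fine (P G) <= \sum_(F | g F) \prod_i p i (F i) + n%:R * eta].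
Proof.
move=> dl0 dlt eta0 conc.
have /choice[K hK] : forall i, exists K, 0 < K /\
    forall l, K <= l -> fine (P [set w | ~ (- l <= X i w < l)]) <= eta.
  by move=> i; have [K K0 hK] := tightness (X i) eta0; exists K.
(* Chosen so that [[-L, L[] contains every [[-K i, K i[] and splits into [k + k] cells. *)
pose k := (Num.truncn ((\sum_i K i) / dl)).+1.
pose L := k%:R * dl.
have KL i : K i <= L.
  have K0 : 0 <= (\sum_i K i) / dl.
    by rewrite divr_ge0 ?(ltW dl0) // sumr_ge0 // => j _; rewrite ltW //; case: (hK j).
  have /andP[_ /ltW] := truncn_itv K0; rewrite ler_pdivrMr // -/k -/L; apply: le_trans.
  by rewrite (bigD1 i) //= lerDl sumr_ge0 // => j _; rewrite ltW //; case: (hK j).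
pose cell (s : option 'I_(k + k)) : set R := if s is Some j
  then [set` `[- L + j%:R * dl, - L + j.+1%:R * dl[] else ~` `[- L, L[.
have mcell s : measurable (cell s) by case: s => [j|]; [|apply: measurableC]; exact: measurable_itv.
pose x (s : option 'I_(k + k)) := if s is Some j then - L + j%:R * dl else 0.
have cell_ex y : exists s, cell s y.
  have [yL|yL] := boolP (y \in `[- L, L[); last by exists None => /=; apply/negP.
  move: (yL); rewrite in_itv /= => /andP[y1 y2].
  have y0 : 0 <= (y + L) / dl by rewrite divr_ge0 ?(ltW dl0) //; lra.
  have /andP[j1 j2] := truncn_itv y0.
  have jk : (Num.truncn ((y + L) / dl) < k + k)%N.
    rewrite -(ltr_nat R); apply: le_lt_trans j1 _; rewrite ltr_pdivrMr // natrD mulrDl -/L.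
    lra.
  exists (Some (Ordinal jk)) => /=; rewrite in_itv /=.
  move: j1 j2; rewrite ler_pdivlMr // ltr_pdivrMr // => j1 j2; apply/andP; split; lra.
have cell_uniq s s' y : cell s y -> cell s' y -> s = s'.
  have inL (j : 'I_(k + k)) : cell (Some j) y -> y \in `[- L, L[.
    rewrite /= !in_itv /= => /andP[h1 h2]; apply/andP; split.
      by apply: le_trans h1; rewrite lerDl mulr_ge0 // ltW.
    apply: lt_le_trans h2 _; rewrite addrC lerBlDr /L -mulrDl ler_wpM2r ?(ltW dl0) //.
    by rewrite -natrD ler_nat.
  have idx (j : 'I_(k + k)) : cell (Some j) y -> Num.truncn ((y + L) / dl) = j.
    rewrite /= in_itv /= => /andP[h1 h2]; apply: truncn_def.
    by rewrite ler_pdivlMr // ltr_pdivrMr //; apply/andP; split; lra.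
  case: s => [j|]; case: s' => [j'|] // h h'.
  - by congr Some; apply: val_inj; rewrite /= -(idx j h) (idx j' h').
  - by case: h'; apply: inL h.
  - by case: h; apply: inL h'.
have cell_near j y : cell (Some j) y -> `|y - x (Some j)| <= dl.
  rewrite /= in_itv /= -natr1 mulrDl mul1r => /andP[h1 h2].
  by rewrite ler_norml; apply/andP; split; lra.
pose p i s := fine (P (X i @^-1` cell s)).
have p_sum i (Q : pred (option 'I_(k + k))) : \sum_(s | Q s) p i s =
    fine (P (\bigcup_(s in [set` [seq s <- index_enum _ | Q s]]) X i @^-1` cell s)).
  rewrite fine_prob_bigcup; first by rewrite big_filter.
  - by move=> s; exact: mX.
  - by move=> s s' w; exact: cell_uniq.
  - by rewrite filter_uniq // index_enum_uniq.
exists (option 'I_(k + k)), p, x; split.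
- by move=> i s; exact: fine_prob_ge0.
- move=> i; rewrite p_sum (_ : \bigcup_(_ in _) _ = setT) ?probability_setT //.
  apply/seteqP; split => // w _; have [s hs] := cell_ex (X i w).
  by exists s => //=; rewrite mem_filter mem_index_enum.
- move=> i v.
  apply: (@le_trans _ _ (\sum_(s | (s != None) && (`|x s - v| <= t)) p i s + p i None)).
    rewrite (bigID (fun s => s != None)) /=; apply: lerD.
      by rewrite le_eqVlt; apply/orP; left; apply/eqP; apply: eq_bigl => s; rewrite andbC.
    rewrite big_mkcond (bigD1 None) //= big1 ?addr0; last first.
      by move=> s ->; rewrite andbF.
    by case: ifP => // _; exact: fine_prob_ge0.
  apply: lerD; last first.
    case: (hK i) => _ /(_ L (KL i)); apply: le_trans; apply: fine_prob_le; first exact: mX.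
    - rewrite (_ : [set w | _] = X i @^-1` (~` `[- L, L[)); first by apply: mX; exact: measurableC.
      by apply/seteqP; split => w /=; rewrite in_itv.
    - by move=> w; rewrite /= in_itv.
  rewrite p_sum; set U := \bigcup_(_ in _) _.
  have mU : measurable U by apply: fin_bigcup_measurable => // s _; exact: mX.
  (* A value rounded down into [[v - t, v + t]] lies in [[v - t, v + t + dl]]; as [dl <= t], the
     balls around [v] and [v + t] cover it, whence [2 * q]. *)
  have m1 := measurable_dist_le (X i) v t.
  have m2 := measurable_dist_le (X i) (v + t) t.
  apply: (@le_trans _ _ (fine (P
      ([set w | `|X i w - v| <= t] `|` [set w | `|X i w - (v + t)| <= t])))).
    apply: fine_prob_le => //; first exact: measurableU.
    move=> w [[j|]]; rewrite /= mem_filter //= => /andP[jv _].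
    rewrite in_itv /= -natr1 mulrDl mul1r; move: jv; rewrite ler_norml.
    move=> /andP[h1 h2] /andP[h3 h4].
    by have [h5|h5] := leP (X i w) (v + t); [left|right] => /=; rewrite ler_norml;
      apply/andP; split; lra.
  rewrite -lee_fin EFin_fine_prob; last exact: measurableU.
  apply: le_trans (measureU2 P m1 m2) _.
  rewrite -[X in (X + _ <= _)%E](EFin_fine_prob P m1).
  rewrite -[X in (_ + X <= _)%E](EFin_fine_prob P m2) -EFinD lee_fin.
  by have := conc i v; have := conc i (v + t); lra.
move=> G g mG Gg.
pose box F := \bigcap_(i in [set` [set: 'I_n]%SET]) (X i @^-1` cell (F i)).
pose rF := [seq F <- index_enum {ffun 'I_n -> option 'I_(k + k)} | g F].
have mbox F : measurable (box F) by apply: fin_bigcap_measurable => // i _; exact: mX.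
pose U1 := \bigcup_(F in [set` rF]) box F.
pose U2 := \bigcup_(i in [set` index_enum 'I_n]) (X i @^-1` cell None).
have mU1 : measurable U1 by apply: fin_bigcup_measurable.
have mU2 : measurable U2 by apply: fin_bigcup_measurable => // i _; exact: mX.
apply: (@le_trans _ _ (fine (P (U1 `|` U2)))).
  apply: fine_prob_le => //; first exact: measurableU.
  move=> w Gw; have /choice[f hf] : forall i, exists s, cell s (X i w) by move=> i.
  have [[i fi]|fS] := pselect (exists i, f i = None).
    by right; exists i; rewrite /= ?mem_index_enum //; have := hf i; rewrite fi.
  left; exists (finfun f); last by move=> i _; rewrite /= ffunE; exact: hf.
  rewrite /= mem_filter mem_index_enum andbT; apply: (Gg w) => // i.
  rewrite ffunE; case E : (f i) => [j|]; last by case: fS; exists i.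
  by apply: cell_near; rewrite -E; exact: hf.
rewrite -lee_fin EFin_fine_prob; last exact: measurableU.
apply: le_trans (measureU2 P mU1 mU2) _.
rewrite -[X in (X + _ <= _)%E](EFin_fine_prob P mU1).
rewrite -[X in (_ + X <= _)%E](EFin_fine_prob P mU2) -EFinD lee_fin; apply: lerD.
  apply: le_trans (fine_prob_bigcup_le P rF mbox) _.
  by rewrite big_filter; apply: ler_sum => F _; rewrite fine_prob_box.
have mN i : measurable (X i @^-1` cell None) by exact: mX.
apply: le_trans (fine_prob_bigcup_le P _ mN) _.
rewrite -[X in X%:R * _](card_ord n) -sum1_card natr_sum mulr_suml; apply: ler_sum => i _.
rewrite mul1r; case: (hK i) => _ /(_ L (KL i)); apply: le_trans.
apply: fine_prob_le; first exact: mX.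
- rewrite (_ : [set w | _] = X i @^-1` (~` `[- L, L[)); first by apply: mX; exact: measurableC.
  by apply/seteqP; split => w /=; rewrite in_itv.
- by move=> w; rewrite /= in_itv.
Qed.

End Discretization.

(** * Small balls for general independent variables *)

Section SmallBall.
Variables (d : measure_display) (T : measurableType d) (R : realType).
Variables (P : probability T R) (n : nat) (X : 'I_n -> {RV P >-> R}).
Variables (m : nat) (A : 'M[R]_(m, n)).

Lemma measurable_l2norm_le (u : 'cV[R]_m) (s : R) :
  measurable [set w | l2norm (A *m random_vector X w - u) <= s].
Proof.
have [s0|s0] := ltP s 0.
  rewrite (_ : [set w | _] = set0); first exact: measurable0.
  apply/seteqP; split => // w /=; rewrite leNgt (lt_le_trans s0) //.
  by rewrite l2normE sqrtr_ge0.
pose f w := \sum_(k < m) (\sum_(j < n) A k j * X j w - u k 0) ^+ 2.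
have fE w : dot (A *m random_vector X w - u) (A *m random_vector X w - u) = f w.
  rewrite dotE; apply: eq_bigr => k _; rewrite -expr2 !mxE.
  by congr ((_ - _) ^+ 2); apply: eq_bigr => j _; rewrite mxE.
rewrite (_ : [set w | _] = setT `&` [set w | f w <= s ^+ 2]); last first.
  rewrite setTI; apply/seteqP; split => w /=; rewrite l2normE fE => h.
    rewrite -(@sqr_sqrtr _ (f w)) ?lerXn2r ?nnegrE ?sqrtr_ge0 //.
    by rewrite -fE dot_ge0.
  by rewrite -(ger0_norm s0) -sqrtr_sqr ler_wsqrtr.
apply: measurable_fun_le => //; apply: measurable_sum => k.
apply: measurable_funX; apply: measurable_funB => //.
apply: measurable_sum => j; apply: measurable_funM => //.
Qed.

(** Rounding with step [t / n] moves the vector by at most [t], hence its image by at most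
    [t * hs_norm A]. The radius at most doubles, which is the factor 4 in [finite_small_ball]. *)
Lemma fine_prob_small_ball (t q eta M eps : R) u (D : nat) :
  mutually_independent X -> A != 0 -> 0 < t -> 0 <= q ->
  (forall i v, fine (P [set w | `|X i w - v| <= t]) <= q) ->
  1 <= M -> 0 < eps -> eps < 1 -> 0 < eta -> (0 < D)%N ->
  (forall k, (k < D)%N -> k%:R < (1 - eps) * (hs2 A / op_norm A ^+ 2)) ->
  fine (P [set w | l2norm (A *m random_vector X w - u) <= M * t * hs_norm A]) <=
  (128 ^+ 2 * expR 5 / Num.sqrt eps * M * (2 * q + eta)) ^+ D + n%:R * eta.
Proof.
move=> indep A0 t0 q0 conc M1 e0 e1 eta0 D0 hD.
have M0 : 0 < M by apply: lt_le_trans M1.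
have h0 : 0 < hs2 A.
  rewrite lt_def hs2_ge0 andbT; apply: contra A0 => /eqP h.
  apply/eqP/matrixP => i j; rewrite mxE.
  have /eqP : dot (col j A) (col j A) = 0.
    apply/eqP; rewrite eq_le dot_ge0 andbT -h /hs2 (bigD1 j) //= lerDl.
    by apply: sumr_ge0 => k _; rewrite dot_ge0.
  by rewrite dot_eq0 => /eqP /matrixP /(_ i 0); rewrite !mxE.
have n0 : (0 < n)%N.
  case: (n) A h0 => [|//] A' ; by rewrite /hs2 big_ord0 ltxx.
have nR : 0 < n%:R :> R by rewrite ltr0n.
have n1 : 1 <= n%:R :> R by rewrite ler1n.
pose dl := t / n%:R.
have dl0 : 0 < dl by rewrite divr_gt0.
have dlt : dl <= t by rewrite ler_pdivrMr // ler_peMr // ltW.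
have [S [p [x [p0 p1 pc apx]]]] := discretization indep dl0 dlt eta0 conc.
pose x' (i : 'I_n) s := x s / t.
have conc' i v : \sum_(s | `|x' i s - v| <= 1) p i s <= 2 * q + eta.
  apply: le_trans (pc i (v * t)); rewrite le_eqVlt; apply/orP; left; apply/eqP.
  apply: eq_bigl => s; rewrite /x'.
  have -> : x s / t - v = (x s - v * t) / t by rewrite mulrBl mulfK ?gt_eqF.
  by rewrite normrM normfV (gtr0_norm t0) ler_pdivrMr // mul1r.
have q'0 : 0 < 2 * q + eta by rewrite ltr_wpDl // mulr_ge0.
pose z F := A *m value x' F - t^-1 *: u.
pose g F := dot (z F) (z F) <= 4 * (M ^+ 2 * hs2 A).
have bound : \sum_(F | g F) \prod_i p i (F i) <=
    (128 ^+ 2 * expR 5 / Num.sqrt eps * M * (2 * q + eta)) ^+ D.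
  apply: (finite_small_ball p0 p1 conc' q'0 (t^-1 *: u) h0 M1 e0 D0 (sqr_ge0 (op_norm A))).
    exact: dot_trmx_le_op.
  (* The hypothesis on [k] means [k * tau <= (1 - eps) * hs2 A]. If [op_norm A ^+ 2 = 0] the
     quotient is a default value, but then [k * tau = 0]. *)
  move=> k kD; have [op0|op0] := eqVneq (op_norm A ^+ 2) 0.
    by rewrite op0 mulr0 subr0 ler_piMl ?hs2_ge0 // ltW.
  have opp : 0 < op_norm A ^+ 2 by rewrite lt_def op0 sqr_ge0.
  by have := hD k kD; rewrite mulrA ltr_pdivlMr //; lra.
apply: le_trans (lerD bound (lexx _)); apply: apx; first exact: measurable_l2norm_le.
move=> w F near; rewrite /= l2normE hs_normE => Gw; rewrite /g.
pose y := A *m random_vector X w - u.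
pose e : 'cV[R]_n := \col_i (x (F i) - X i w).
have zE : z F = t^-1 *: (y + A *m e).
  have -> : y + A *m e = A *m (\col_i x (F i)) - u.
    rewrite /y addrAC -mulmxDr; congr (A *m _ - u).
    by apply/matrixP => i j; rewrite !mxE addrC subrK.
  rewrite scalerBr scalemxAr; congr (A *m _ - _).
  by apply/matrixP => i j; rewrite !mxE /x' mulrC.
have yb : dot y y <= M ^+ 2 * t ^+ 2 * hs2 A.
  have := Gw; rewrite -(@ler_pXn2r _ 2) ?nnegrE ?mulr_ge0 ?sqrtr_ge0 ?(ltW M0) ?(ltW t0) //.
  by rewrite sqr_sqrtr ?dot_ge0 // !exprMn sqr_sqrtr ?hs2_ge0.
have eb : dot e e <= M ^+ 2 * t ^+ 2.
  rewrite dotE; apply: (@le_trans _ _ (\sum_(i < n) dl ^+ 2)).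
    apply: ler_sum => i _; rewrite !mxE -expr2 -(@real_normK _ (x (F i) - X i w)) ?num_real //.
    by rewrite lerXn2r ?nnegrE ?(ltW dl0) // distrC near.
  rewrite sumr_const card_ord -mulr_natl /dl.
  have -> : n%:R * (t / n%:R) ^+ 2 = t ^+ 2 / n%:R by field; rewrite gt_eqF.
  rewrite ler_pdivrMr // mulrAC ler_peMl ?sqr_ge0 //.
  have M2 : 1 <= M ^+ 2 by rewrite expr_ge1 // ltW.
  by rewrite (le_trans M2) // ler_peMr // (le_trans ler01).
have t2 : 0 < t ^+ 2 by rewrite exprn_gt0.
rewrite zE dotZl dotZr mulrA -expr2 exprVn ler_pdivrMl //.
apply: le_trans (dotD_le _ _) _.
have := le_trans (dot_mulmx_le_hs2 A e) (ler_wpM2l (hs2_ge0 A) eb).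
lra.
Qed.

End SmallBall.

(** * Removal of the error terms and conclusion *)

Lemma le_right_limit_poly (R : realType) (a p b c : R) D : 
  (forall eta, 0 < eta -> a <= (b * (2 * (p + eta) + eta)) ^+ D + c * eta) ->
  a <= (b * (2 * p)) ^+ D.
Proof.
move=> h.
have cv : (fun eta : R => (b * (2 * (p + eta) + eta)) ^+ D + c * eta) x @[x --> (0 : R)^'+] -->
    (b * (2 * (p + 0) + 0)) ^+ D + c * 0.
  apply: cvg_at_right_filter; apply: cvgD.
    apply: (@cvg_comp _ _ _ (fun eta : R => b * (2 * (p + eta) + eta))
      (fun y => y ^+ D)); last first.
      exact: exprn_continuous.
    apply: cvgM; first exact: cvg_cst.
    apply: cvgD; last exact: cvg_id.
    apply: cvgM; first exact: cvg_cst.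
    by apply: cvgD; [exact: cvg_cst|exact: cvg_id].
  by apply: cvgM; [exact: cvg_cst|exact: cvg_id].
rewrite addr0 addr0 mulr0 addr0 in cv.
apply: (ler_cvg_to (cvg_cst a) cv).
by near=> eta; apply: h; near: eta; exact: nbhs_right_gt.
Unshelve. all: by end_near. Qed.

Theorem corollary8p5 (R : realType) :
  exists C : R, 0 < C /\
    forall (d : measure_display) (T : measurableType d) (P : probability T R)
      (n : nat) (X : 'I_n -> {RV P >-> R}) (t p : R),
      mutually_independent X ->
      0 <= t -> 0 <= p ->
      (forall i : 'I_n, (concentration P (scalar_vector (X i)) t <= p%:E)%E) ->
      forall (m : nat) (A : 'M[R]_(m, n)) (M eps : R),
        A != 0 -> 1 <= M -> 0 < eps -> eps < 1 ->
        (concentration P (fun w => A *m random_vector X w) (M * t * hs_norm A)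
         <= ((C / Num.sqrt eps * M * p)
               ^ Num.ceil ((1 - eps) * (stable_rank A)%:~R))%:E)%E.
Proof.
pose K : R := 128 ^+ 2 * expR 5.
have K0 : 0 < K by rewrite mulr_gt0 ?expR_gt0.
(* The factor 2 is the loss from [q] to [2 * q] in rounding. *)
exists (2 * K); split; first by rewrite mulr_gt0.
move=> d T P n X t p indep t0 p0 conc m A M eps A0 M1 e0 e1.
have conc1 i v : fine (P [set w | `|X i w - v| <= t]) <= p.
  rewrite -lee_fin EFin_fine_prob; last exact: measurable_dist_le.
  apply: le_trans (conc i); apply: ereal_sup_ubound; exists (\col_(k < 1) v) => //.
  congr (P _); apply/seteqP; split => w /=;
    by rewrite l2normE dotE big_ord1 !mxE -expr2 sqrtr_sqr.
apply: ge_ereal_sup => _ [u _ <-].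
have mG := measurable_l2norm_le X A u (M * t * hs_norm A).
rewrite -EFin_fine_prob // lee_fin.
set y := (1 - eps) * _.
have r0 : 0 <= hs_norm A ^+ 2 / op_norm A ^+ 2 by rewrite divr_ge0 ?sqr_ge0.
have y0 : 0 <= y.
  by rewrite mulr_ge0 ?subr_ge0 ?(ltW e1) // ler0z floor_ge0.
have [D DE] : exists D : nat, Num.ceil y = D%:Z.
  exists `|Num.ceil y|%N; rewrite gez0_abs // ceil_ge0.
  by apply: lt_le_trans y0; rewrite ltrN10.
rewrite DE -exprnP.
have [->|D0] := posnP D.
  by rewrite expr0 -lee_fin EFin_fine_prob // probability_le1.
have -> : 2 * K / Num.sqrt eps * M * p = K / Num.sqrt eps * M * (2 * p) by ring.
(* [eta] is at once the slack in the concentration bound and the tail mass lost in rounding; it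
   tends to zero with [D] fixed. *)
apply: (@le_right_limit_poly _ _ _ _ n%:R) => eta eta0.
(* Rescaling by the radius requires it to be positive; for [t = 0] the bound on atoms extends to a
   small radius at the cost of [eta]. *)
have [t' [t'0 tt' conc']] : exists t' : R, [/\ 0 < t', t <= t' &
    forall i v, fine (P [set w | `|X i w - v| <= t']) <= p + eta].
  have [t1|t1] := ltP 0 t.
    by exists t; split => // i v; apply: le_trans (conc1 i v) _; rewrite lerDl ltW.
  have t00 : t = 0 by apply/eqP; rewrite eq_le t1.
  rewrite t00 in conc1 *.
  have /choice[s hs] : forall i, exists s : R, 0 < s /\
      forall v, fine (P [set w | `|X i w - v| <= s]) <= p + eta.
    by move=> i; have [s s0 hs] := conc_right_continuous0 eta0 (conc1 i); exists s.
  pose s' := \big[Num.min/1]_i s i.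
  have s'0 : 0 < s'.
    by apply: (big_ind (fun z : R => 0 < z)) => // [a b a0 b0|i _];
      [rewrite lt_min a0|case: (hs i)].
  exists s'; split => // [|i v]; first exact: ltW.
  case: (hs i) => _ /(_ v); apply: le_trans.
  apply: fine_prob_le; try exact: measurable_dist_le.
  by move=> w /= h; apply: le_trans h _; rewrite /s' (bigD1 i) //= ge_min lexx.
have pe : 0 <= p + eta by rewrite addr_ge0 // ltW.
apply: le_trans (fine_prob_small_ball u indep A0 t'0 pe conc' M1 e0 e1 eta0 D0 _).
  apply: fine_prob_le => //; first exact: measurable_l2norm_le.
  move=> w /= h; apply: le_trans h _; rewrite ler_wpM2r ?sqrtr_ge0 //.
  by rewrite ler_wpM2l // (le_trans ler01).
(* For an integer [k], [k < ceil y] already gives [k < y], and the floor in [stable_rank] only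
   lowers [y]. *)
move=> k kD; have : (k%:Z < Num.ceil y)%R by rewrite DE ltz_nat.
rewrite ceil_gt_int => h; apply: lt_le_trans h _.
rewrite /y ler_wpM2l ?subr_ge0 ?(ltW e1) // /stable_rank.
apply: le_trans (floor_le _) _; rewrite hs_normE sqr_sqrtr ?hs2_ge0 //.
Qed.
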